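(* Consider the semi-discrete oscillation-free discontinuous Galerkin (OFDG) scheme for the two-dimensional shallow water equations described in the context: find $\mathbf{U}_h(\cdot,t)\in[V_h^k]^3$ such that for every element $K\in\mathcal{T}_h$ and every $\mathbf{v}_h\in[V_h^k]^3$, $\int_K(\mathbf{U}_h)_t\cdot\mathbf{v}_h\,dx\,dy=Res_K(\mathbf{U}_h;\mathbf{v}_h)$, where $$\begin{aligned}Res_K(\mathbf{U}_h;\mathbf{v}_h)=&\int_K\mathbf{F}(\mathbf{U}_h)\cdot(\mathbf{v}_h)_x+\mathbf{G}(\mathbf{U}_h)\cdot(\mathbf{v}_h)_y\,dx\,dy-\int_{\partial K}\big(\widehat{\mathbf{F}}^{\partial K}(\mathbf{U}_h)n_1+\widehat{\mathbf{G}}^{\partial K}(\mathbf{U}_h)n_2\big)\cdot\mathbf{v}_h\,ds\\&+\int_K\mathbf{S}(\mathbf{U}_h,b_h)\cdot\mathbf{v}_h\,dx\,dy-\sum_{\ell=0}^k\frac{\sigma_K^\ell(\mathbf{U}_h)}{\Delta_K}\int_K\big(\widetilde{\mathbf{U}}_h-P_h^{\ell-1}\widetilde{\mathbf{U}}_h\big)\cdot\mathbf{v}_h\,dx\,dy.\end{aligned}$$ This scheme preserves the well-balanced property for the still water stationary state $hu=hv=0$, $h+b=\text{constant}$. That is, if $\mathbf{U}_h=(h_h,(hu)_h,(hv)_h)^T\in[V_h^k]^3$ satisfies $(hu)_h\equiv(hv)_h\equiv0$ and $h_h+b_h\equiv\text{constant}$, then $Res_K(\mathbf{U}_h;\mathbf{v}_h)=0$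 for every $K\in\mathcal{T}_h$ and every $\mathbf{v}_h\in[V_h^k]^3$.
   Context: **Equations.** The two-dimensional shallow water equations on $\Omega\subset\mathbb{R}^2$ are $h_t+(hu)_x+(hv)_y=0$, $(hu)_t+(hu^2+\frac12gh^2)_x+(huv)_y=-ghb_x$, $(hv)_t+(huv)_x+(hv^2+\frac12gh^2)_y=-ghb_y$, where $h$ is the water height, $(u,v)$ the velocity, $b(x,y)$ the bottom topography and $g>0$ the gravitational constant. Write $\mathbf{U}=(h,hu,hv)^T$, $\mathbf{F}(\mathbf{U})=(hu,\,hu^2+\frac12gh^2,\,huv)^T$, $\mathbf{G}(\mathbf{U})=(hv,\,huv,\,hv^2+\frac12gh^2)^T$, $\mathbf{S}(\mathbf{U},b)=(0,-ghb_x,-ghb_y)^T$. These are functions of the conserved variables, with $u=(hu)/h$, $v=(hv)/h$ for $h>0$; all states considered have $h>0$. **Mesh and spaces.** $\mathcal{T}_h$ is a regular partition of $\Omega$ into polygonal elements $K$, $\Delta_K=\operatorname{diam}K$, $\Delta_{\mathcal{T}_h}=\max_K\Delta_K$. For an integer $k\ge1$, $V_h^k$ is the space of functions whose restriction to each $K$ is a polynomial of degree at most $k$. $b_h\in V_h^k$ is the $L^2$ projection of $b$, and $\mathbf{S}(\mathbf{U}_h,b_h)=(0,-gh_h(b_h)_x,-gh_h(b_h)_y)^T$ in each element. $\mathbf{n}=(n_1,n_2)^T$ is the unit outward normal on $\partial K$. In the boundary integral $\mathbf{v}_h$ is the trace from inside $K$. On edges lying on $\partial\Omega$ the exterior traces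 of $\mathbf{U}_h$ and $b_h$ are supplied by the boundary conditions; the still water condition is understood to hold, with the same constant, for these exterior traces too. All integrals are exact. **Numerical fluxes (hydrostatic reconstruction).** On an edge of $K$ let superscripts $int$, $ext$ denote traces from inside and outside $K$. Set $b_h^*=\max(b_h^{int},b_h^{ext})$, $h_h^{*,int}=\max(0,(h_h+b_h)^{int}-b_h^* )$, $h_h^{*,ext}=\max(0,(h_h+b_h)^{ext}-b_h^* )$, and let $\mathbf{U}_h^{*,int}=(h_h^{*,int},(hu)_h^{int},(hv)_h^{int})^T$, $\mathbf{U}_h^{*,ext}=(h_h^{*,ext},(hu)_h^{ext},(hv)_h^{ext})^T$. Let $\widehat{\mathbf{F}},\widehat{\mathbf{G}}$ be consistent numerical fluxes (possibly depending on $\mathbf{n}$; e.g. Lax–Friedrichs), i.e. $\widehat{\mathbf{F}}(\mathbf{U},\mathbf{U})=\mathbf{F}(\mathbf{U})$ and $\widehat{\mathbf{G}}(\mathbf{U},\mathbf{U})=\mathbf{G}(\mathbf{U})$. Then $$\widehat{\mathbf{F}}^{\partial K}=\widehat{\mathbf{F}}(\mathbf{U}_h^{*,int},\mathbf{U}_h^{*,ext})+\Big(0,\ \tfrac g2\big((h_h^{int})^2-(h_h^{*,int})^2\big),\ 0\Big)^T,$$ $$\widehat{\mathbf{G}}^{\partial K}=\widehat{\mathbf{G}}(\mathbf{U}_h^{*,int},\mathbf{U}_h^{*,ext})+\Big(0,\ 0,\ \tfrac g2\big((h_h^{int})^2-(h_h^{*,int})^2\big)\Big)^T.$$ **Damping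 term.** $\widetilde{\mathbf{U}}_h=(h_h+b_h,(hu)_h,(hv)_h)^T$. For $\ell\ge0$, $P_h^\ell$ is the (componentwise, elementwise) $L^2$ projection onto $[V_h^\ell]^3$, and $P_h^{-1}:=P_h^0$. The damping coefficients are $$\sigma_K^\ell=\frac{2(2\ell+1)}{2k-1}\frac{(\Delta_{\mathcal{T}_h})^\ell}{\ell!}\max_{1\le s\le3}\sum_{|\boldsymbol\alpha|=\ell}\bigg(\frac1{N_e}\sum_{\boldsymbol v\in\partial K}\Big([\![\partial^{\boldsymbol\alpha}V_s]\!]\big|_{\boldsymbol v}\Big)^2\bigg)^{1/2},$$ where $\boldsymbol\alpha=(\alpha_1,\alpha_2)$ is a multi-index of non-negative integers, $|\boldsymbol\alpha|=\alpha_1+\alpha_2$, $\partial^{\boldsymbol\alpha}w=\partial_x^{\alpha_1}\partial_y^{\alpha_2}w$, $N_e$ is the number of edges of $K$, the inner sum is over the vertices $\boldsymbol v$ of $K$, and $\big([\![w]\!]|_{\boldsymbol v}\big)^2$ denotes the sum, over the two edges of $K$ meeting at $\boldsymbol v$, of $(w|_K-w|_{K'})^2$ at $\boldsymbol v$, with $K'$ the neighbour of $K$ across that edge. Here $\mathbf{V}=\mathbf{R}^{-1}\mathbf{U}_h$ are characteristic variables, with $\partial^{\boldsymbol\alpha}\mathbf{V}=\mathbf{R}^{-1}\partial^{\boldsymbol\alpha}\mathbf{U}_h$, where on each edge $$\mathbf{R}^{-1}=\begin{pmatrix}c-un_1-vn_2&n_1&n_2\\2(un_2-vn_1)&-2n_2&2n_1\\c+un_1+vn_2&-n_1&-n_2\end{pmatrix},\qquad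 c=\sqrt{gh},$$ evaluated at an average (mean or Roe average) of the two traces of $\mathbf{U}_h$ on that edge (it comes from the characteristic decomposition $n_1\mathbf{F}'+n_2\mathbf{G}'=\mathbf{R}\boldsymbol\Lambda\mathbf{R}^{-1}$ at that average). *)

(* Defs.v *)
From HB Require Import structures.
From mathcomp Require Import all_boot all_order all_algebra.
From mathcomp Require Import all_classical all_reals all_analysis.

Set Implicit Arguments.
Unset Strict Implicit.
Unset Printing Implicit Defensive.
Import Order.TTheory GRing.Theory Num.Theory.
Import numFieldNormedType.Exports.
Local Open Scope classical_set_scope.
Local Open Scope ring_scope.

Section Plane.
Variable R : realType.
Implicit Types (a b n x y : R * R) (D : set (R * R)).

(* The library norm on [R * R] is the sup norm; lengths and diameters below
   are Euclidean. *)
Definition dist2 x y : R :=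
  Num.sqrt ((x.1 - y.1) ^+ 2 + (x.2 - y.2) ^+ 2).

Definition diam D : R := sup [set dist2 x y | x in D & y in D].

Definition frontier D : set (R * R) := closure D `\` D°.

Definition segpt a b (t : R) : R * R :=
  ((1 - t) * a.1 + t * b.1, (1 - t) * a.2 + t * b.2).

Definition segment a b : set (R * R) := segpt a b @` `[0, 1].

(* The unit normal to the right of the direction from [a] to [b], hence the
   outward one when the boundary is traversed counterclockwise. *)
Definition rnormal a b : R * R :=
  ((b.2 - a.2) / dist2 a b, - (b.1 - a.1) / dist2 a b).

Definition unit_vector n : Prop := n.1 ^+ 2 + n.2 ^+ 2 = 1.

Definition leb2 := (@lebesgue_measure R \x @lebesgue_measure R)%E.

Definition area_int D (f : R * R -> R) : R := \int[leb2]_(x in D) f x.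

(* Integral of [f] with respect to arc length. *)
Definition seg_int a b (f : R * R -> R) : R :=
  dist2 a b * \int[@lebesgue_measure R]_(t in `[0, 1]) f (segpt a b t).

Definition square_integrable D (f : R * R -> R) : Prop :=
  measurable_fun D f /\ leb2.-integrable D (fun x => (f x ^+ 2)%:E).

(* [D] is the closed region enclosed by the simple closed polygonal curve with
   vertices [p], which is listed counterclockwise.  Consecutive edges may be
   collinear. *)
Record polygon (N : nat) (p : 'I_N -> R * R) D : Prop := Polygon {
  polygon_size : (2 < N)%N;
  polygon_simple : forall (i j : 'I_N) (s t : R),
    0 <= s < 1 -> 0 <= t < 1 ->
    segpt (p i) (p (ordS i)) s = segpt (p j) (p (ordS j)) t ->
    i = j /\ s = t;
  polygon_bounded : exists r : R, forall x y, D x -> D y -> dist2 x y <= r;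
  polygon_regular : D = closure D°;
  polygon_frontier : frontier D = \bigcup_i segment (p i) (p (ordS i));
  polygon_ccw : forall (i : 'I_N) (t : R), 0 < t < 1 ->
    let x := segpt (p i) (p (ordS i)) t in
    let n := rnormal (p i) (p (ordS i)) in
    \forall e \near 0^'+, ~ D (x.1 + e * n.1, x.2 + e * n.2)
}.

End Plane.

(* Finite edge-to-edge partition of [Omega] into polygons.  [nbr K i] is the
   neighbour of [K] across its [i]-th edge, and [None] when this edge lies on
   the boundary of [Omega].  A hanging node is a vertex where two collinear
   edges meet. *)
Record mesh (R : realType) (Omega : set (R * R)) := Mesh {
  elt : finType;
  nedges : elt -> nat;
  vtx : forall K, 'I_(nedges K) -> R * R;
  cell : elt -> set (R * R);
  nbr : forall K, 'I_(nedges K) -> option elt;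
  cell_polygon : forall K, polygon (@vtx K) (cell K);
  mesh_cover : closure Omega = \bigcup_K cell K;
  mesh_interior : forall K, (cell K)° `<=` Omega;
  mesh_disjoint : forall K K', K != K' -> (cell K)° `&` (cell K')° = set0;
  mesh_boundary : forall K (i : 'I_(nedges K)),
    nbr i = None <-> segment (vtx i) (vtx (ordS i)) `<=` frontier Omega;
  mesh_conform : forall K (i : 'I_(nedges K)) K', nbr i = Some K' ->
    K' != K /\ exists j : 'I_(nedges K'),
      vtx j = vtx (ordS i) /\ vtx (ordS j) = vtx i
}.

Section Polynomials.
Variable R : realType.

(* A polynomial in (x, y): [p`_i`_j] is the coefficient of x^i y^j and
   [p.[x, y]] the value. *)
Definition bipoly := {poly {poly R}}.

Implicit Types (p q : bipoly) (U V : 'cV[bipoly]_3).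

Definition bideg_le (k : nat) p : Prop :=
  forall i j : nat, (k < i + j)%N -> p`_i`_j = 0.

Definition peval p (x : R * R) : R := p.[x.1, x.2].

Definition dX p : bipoly := p^`().
Definition dY p : bipoly := map_poly (@deriv R) p.

Definition pder (a1 a2 : nat) p : bipoly := iter a1 dX (iter a2 dY p).

Definition veval U (x : R * R) : 'cV[R]_3 := map_mx (peval^~ x) U.

Definition is_L2proj (D : set (R * R)) (k : nat) (f : R * R -> R) q : Prop :=
  bideg_le k q /\
  forall r : bipoly, bideg_le k r ->
    area_int D (fun x => f x * peval r x) =
    area_int D (fun x => peval q x * peval r x).

(* On a bounded set with nonempty interior, exactly one polynomial satisfies
   [is_L2proj], so that the default value 0 is not used. *)
Definition L2proj (D : set (R * R)) (k : nat) (f : R * R -> R) : bipoly :=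
  xget 0 [set q | is_L2proj D k f q].

End Polynomials.

Section ShallowWater.
Variables (R : realType) (g : R).

Definition col3 (A : nmodType) (a b c : A) : 'cV[A]_3 :=
  \col_i [:: a; b; c]`_i.

Definition dot3 (v w : 'cV[R]_3) : R := \sum_i v i 0 * w i 0.

Definition hgt (A : Type) (U : 'cV[A]_3) : A := U 0 0.
Definition hu (A : Type) (U : 'cV[A]_3) : A := U 1 0.
Definition hv (A : Type) (U : 'cV[A]_3) : A := U 2 0.
Definition velu (U : 'cV[R]_3) : R := hu U / hgt U.
Definition velv (U : 'cV[R]_3) : R := hv U / hgt U.

Definition fluxF (U : 'cV[R]_3) : 'cV[R]_3 :=
  col3 (hu U)
       (hgt U * velu U ^+ 2 + g / 2 * hgt U ^+ 2)
       (hgt U * velu U * velv U).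

Definition fluxG (U : 'cV[R]_3) : 'cV[R]_3 :=
  col3 (hv U)
       (hgt U * velu U * velv U)
       (hgt U * velv U ^+ 2 + g / 2 * hgt U ^+ 2).

Definition source (U : 'cV[R]_3) (bx by_ : R) : 'cV[R]_3 :=
  col3 0 (- (g * hgt U * bx)) (- (g * hgt U * by_)).

(* The first argument of a numerical flux is the unit normal; the other two
   are the states inside and outside. *)
Definition numflux := R * R -> 'cV[R]_3 -> 'cV[R]_3 -> 'cV[R]_3.

Definition consistent (H : numflux) (f : 'cV[R]_3 -> 'cV[R]_3) : Prop :=
  forall (n : R * R) (U : 'cV[R]_3), unit_vector n -> 0 < hgt U -> H n U U = f U.

Definition rec_height (U : 'cV[R]_3) (b bstar : R) : R :=
  Num.max 0 (hgt U + b - bstar).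

Definition rec_state (U : 'cV[R]_3) (b bstar : R) : 'cV[R]_3 :=
  col3 (rec_height U b bstar) (hu U) (hv U).

Definition hydroF (Fh : numflux) (n : R * R) (Ui Ue : 'cV[R]_3) (bi be : R) :=
  let bs := Num.max bi be in
  Fh n (rec_state Ui bi bs) (rec_state Ue be bs)
  + col3 0 (g / 2 * (hgt Ui ^+ 2 - rec_height Ui bi bs ^+ 2)) 0.

Definition hydroG (Gh : numflux) (n : R * R) (Ui Ue : 'cV[R]_3) (bi be : R) :=
  let bs := Num.max bi be in
  Gh n (rec_state Ui bi bs) (rec_state Ue be bs)
  + col3 0 0 (g / 2 * (hgt Ui ^+ 2 - rec_height Ui bi bs ^+ 2)).

Inductive average_kind := Mean | Roe.

Definition mean_state (U V : 'cV[R]_3) : 'cV[R]_3 := 2^-1 *: (U + V).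

Definition roe_state (U V : 'cV[R]_3) : 'cV[R]_3 :=
  let h := (hgt U + hgt V) / 2 in
  let sU := Num.sqrt (hgt U) in
  let sV := Num.sqrt (hgt V) in
  col3 h (h * ((sU * velu U + sV * velu V) / (sU + sV)))
         (h * ((sU * velv U + sV * velv V) / (sU + sV))).

Definition average (av : average_kind) (U V : 'cV[R]_3) : 'cV[R]_3 :=
  if av is Mean then mean_state U V else roe_state U V.

Definition Rinv (n : R * R) (U : 'cV[R]_3) : 'M[R]_3 :=
  let u := velu U in let v := velv U in
  let c := Num.sqrt (g * hgt U) in
  \matrix_(i, j)
    (nth [::]
      [:: [:: c - u * n.1 - v * n.2;       n.1;           n.2];
          [:: 2 * (u * n.2 - v * n.1);     - (2 * n.2);   2 * n.1];
          [:: c + u * n.1 + v * n.2;       - n.1;         - n.2]] i)`_j.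

End ShallowWater.

Section OFDG.
Variables (R : realType) (Omega : set (R * R)) (M : mesh Omega).
Variables (g : R) (k : nat).

Definition dgfun := elt M -> bipoly R.
Definition dgvec := elt M -> 'cV[bipoly R]_3.

Definition in_Vh (w : dgfun) : Prop := forall K, bideg_le k (w K).
Definition in_Vh3 (w : dgvec) : Prop := forall K i, bideg_le k (w K i 0).

Definition is_L2projection (b : R * R -> R) (bh : dgfun) : Prop :=
  forall K, is_L2proj (cell K) k b (bh K).

(* Boundary data, used only on the edges lying on the boundary of the domain:
   [Uext K i a1 a2 x] is the exterior trace at [x] of the derivative of U_h of
   order [a1] in x and [a2] in y (no relation between the derivatives is
   imposed), and [bext K i x] that of b_h. *)
Definition bdata_state := forall K : elt M,
  'I_(nedges K) -> nat -> nat -> R * R -> 'cV[R]_3.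
Definition bdata_bottom := forall K : elt M, 'I_(nedges K) -> R * R -> R.

Variables (Fh Gh : numflux R) (av : average_kind).
Variables (Uext : bdata_state) (bext : bdata_bottom).
Variables (U : dgvec) (bh : dgfun).

Definition DeltaT : R := \big[Num.max/0]_(K : elt M) diam (cell K).

Definition normal (K : elt M) (i : 'I_(nedges K)) : R * R :=
  rnormal (vtx i) (vtx (ordS i)).

Definition derU_int (K : elt M) (a1 a2 : nat) (x : R * R) : 'cV[R]_3 :=
  veval (map_mx (pder a1 a2) (U K)) x.

Definition derU_ext (K : elt M) (i : 'I_(nedges K)) (a1 a2 : nat) (x : R * R) :=
  if nbr i is Some K' then derU_int K' a1 a2 x else Uext i a1 a2 x.

Definition U_int (K : elt M) (x : R * R) : 'cV[R]_3 := veval (U K) x.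
Definition U_ext (K : elt M) (i : 'I_(nedges K)) (x : R * R) : 'cV[R]_3 :=
  derU_ext i 0 0 x.

Definition b_int (K : elt M) (x : R * R) : R := peval (bh K) x.
Definition b_ext (K : elt M) (i : 'I_(nedges K)) (x : R * R) : R :=
  if nbr i is Some K' then b_int K' x else bext i x.

Definition charjump (K : elt M) (i : 'I_(nedges K)) (a1 a2 : nat) (x : R * R) :
    'cV[R]_3 :=
  Rinv g (normal i) (average av (U_int K x) (U_ext i x))
    *m (derU_int K a1 a2 x - derU_ext i a1 a2 x).

(* The two edges meeting at vertex [j] are edge [j], which starts there, and
   edge [ord_pred j], which ends there. *)
Definition vertexjump2 (K : elt M) (s : 'I_3) (a1 a2 : nat)
    (j : 'I_(nedges K)) : R :=
  (charjump j a1 a2 (vtx j) s 0) ^+ 2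
  + (charjump (ord_pred j) a1 a2 (vtx j) s 0) ^+ 2.

Definition sigma (K : elt M) (l : nat) : R :=
  2 * (2 * l%:R + 1) / (2 * k%:R - 1) * (DeltaT ^+ l / (l`!)%:R) *
  \big[Num.max/0]_(s < 3) \sum_(a < l.+1)
    Num.sqrt ((nedges K)%:R^-1 *
              \sum_(j < nedges K) vertexjump2 s a (l - a) j).

Definition Utilde (K : elt M) : 'cV[bipoly R]_3 :=
  col3 (hgt (U K) + bh K) (hu (U K)) (hv (U K)).

Definition vproj (l : nat) (w : dgvec) (K : elt M) : 'cV[bipoly R]_3 :=
  map_mx (fun p => L2proj (cell K) l (peval p)) (w K).

Definition volume_term (v : dgvec) (K : elt M) : R :=
  area_int (cell K) (fun x =>
    dot3 (fluxF g (U_int K x)) (veval (map_mx (@dX R) (v K)) x)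
    + dot3 (fluxG g (U_int K x)) (veval (map_mx (@dY R) (v K)) x)).

Definition boundary_term (v : dgvec) (K : elt M) : R :=
  \sum_(i < nedges K) seg_int (vtx i) (vtx (ordS i)) (fun x =>
    let n := normal i in
    dot3 (n.1 *: hydroF g Fh n (U_int K x) (U_ext i x) (b_int K x) (b_ext i x)
          + n.2 *: hydroG g Gh n (U_int K x) (U_ext i x) (b_int K x) (b_ext i x))
         (veval (v K) x)).

Definition source_term (v : dgvec) (K : elt M) : R :=
  area_int (cell K) (fun x =>
    dot3 (source g (U_int K x) (peval (dX (bh K)) x) (peval (dY (bh K)) x))
         (veval (v K) x)).

(* [l.-1] is 0 for [l = 0], as in the convention P_h^{-1} = P_h^0. *)
Definition damping_term (v : dgvec) (K : elt M) : R :=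
  \sum_(l < k.+1) sigma K l / diam (cell K) *
    area_int (cell K) (fun x =>
      dot3 (veval (Utilde K - vproj l.-1 Utilde K) x) (veval (v K) x)).

Definition Res (v : dgvec) (K : elt M) : R :=
  volume_term v K - boundary_term v K + source_term v K - damping_term v K.

End OFDG.

(* Main.v *)
(* At rest, the reconstructed states on the two sides of an edge coincide and
   have positive height, so that by consistency the numerical flux is the
   physical flux of the inner state, which is the hydrostatic pressure
   [g / 2 h^2].  Since b_h = C - h_h as polynomials, the source term is the
   gradient of this pressure, and the volume, source and boundary terms cancel
   by the divergence theorem for [g / 2 h^2 v].  The damping term vanishes
   because the components of [Utilde] are constant polynomials, which the
   L2 projections fix.

   The divergence theorem only uses the topological description of a polygon.
   Close to an interior point of an edge, the region is exactly the part of
   the plane on the left of the edge.  Hence on almost every horizontal line the indicator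
   function of the region is a signed count of the edges crossed on the right of
   the point, and integrating a derivative along this line gives the signed sum
   of the values at the crossings.  Fubini's theorem concludes; the other
   coordinate follows by exchanging the axes. *)

Require Import Defs.
From HB Require Import structures.
From mathcomp Require Import all_boot all_order all_algebra.
From mathcomp Require Import all_classical all_reals all_analysis.
From mathcomp Require Import measurable_realfun zify ring lra.

Set Implicit Arguments.
Unset Strict Implicit.
Unset Printing Implicit Defensive.
Import Order.TTheory GRing.Theory Num.Theory.
Import numFieldNormedType.Exports.
Local Open Scope classical_set_scope.
Local Open Scope ring_scope.

(** * Local structure of polygons *)

Section Geometry.
Variable R : realType.
Implicit Types (a b x y z w : R * R) (D : set (R * R)).

Definition esq x (r : R) : set (R * R) :=
  [set w | `|x.1 - w.1| < r /\ `|x.2 - w.2| < r].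

Lemma nbhs_esq x (P : set (R * R)) :
  nbhs x P <-> exists2 r : R, 0 < r & esq x r `<=` P.
Proof.
split=> [/nbhs_ballP[r /= r0 h]|[r r0 h]].
  by exists r => // w [h1 h2]; apply: h; split.
by apply/nbhs_ballP; exists r => //= w [h1 h2]; apply: h; split.
Qed.

Lemma pair_continuous (T : topologicalType) (f g : T -> R) :
  continuous f -> continuous g -> continuous (fun t => (f t, g t)).
Proof. by move=> cf cg t; exact: (cvg_pair (cf t) (cg t)). Qed.

Lemma segpt0 a b : segpt a b 0 = a.
Proof. by rewrite /segpt subr0 !mul1r !mul0r !addr0; case: (a). Qed.

Lemma segpt1 a b : segpt a b 1 = b.
Proof. by rewrite /segpt subrr !mul1r !mul0r !add0r; case: (b). Qed.

Lemma segpt_continuous a b : continuous (segpt a b).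
Proof.
have h (c d : R) : continuous (fun t : R => (1 - t) * c + t * d).
  move=> t; apply: cvgD; apply: cvgM; try exact: cvg_cst; try exact: cvg_id.
  apply: cvgB; [exact: cvg_cst|exact: cvg_id].
exact: (pair_continuous (h _ _) (h _ _)).
Qed.

Lemma segment_closed a b : closed (segment a b).
Proof.
apply: compact_closed; first exact: norm_hausdorff.
apply: continuous_compact; last exact: segment_compact.
by apply: continuous_subspaceT; exact: segpt_continuous.
Qed.

(** Connectedness of [[0, 1]]: if the segment avoided the frontier, the parameters mapped into [D°]
    and into [closure D] would coincide, hence form a clopen set that contains 0 and therefore 1. *)
Lemma segment_cross_frontier D a b : D a -> ~ D b ->
  exists2 t : R, 0 <= t <= 1 & frontier D (segpt a b t).
Proof.
move=> Da Db; apply: contrapT => noF.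
have nF t : t \in `[0, 1] -> ~ frontier D (segpt a b t).
  by move=> t01 Ft; apply: noF; exists t => //; rewrite in_itv in t01.
have E : `[0, 1] `&` (segpt a b @^-1` D°) =
    `[0, 1] `&` (segpt a b @^-1` closure D) :> set R.
  apply/seteqP; split=> t [t01 /= Ft]; split=> //.
    by apply: subset_closure; exact: (@interior_subset (R * R)%type D _ Ft).
  by apply: contrapT => h; apply: (nF t).
have C := @segment_connected R 0 1.
have /(C _) {C} : (`[0, 1] `&` (segpt a b @^-1` D°) : set R) !=set0.
  rewrite E; exists 0; split; first by rewrite /= in_itv/= lexx ler01.
  by rewrite /preimage/= segpt0; exact: subset_closure.
move=> C; apply: Db; rewrite -(segpt1 a b).
have : `[0, 1]%classic (1 : R) by rewrite /= in_itv/= ler01 lexx.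
rewrite -C.
- by move=> [_ /interior_subset].
- exists (segpt a b @^-1` D°) => //.
  by apply: open_comp; [move=> ? _; exact: segpt_continuous|exact: open_interior].
- exists (segpt a b @^-1` closure D); last exact: E.
  apply: closed_comp; [move=> ? _; exact: segpt_continuous|exact: closed_closure].
Qed.

End Geometry.

Section PolygonBoundary.
Variable R : realType.
Implicit Types (a b x y z w : R * R) (D : set (R * R)).

(* Positive on the right of the line from [a] to [b], negative on its left. *)
Definition rside a b w : R :=
  (b.2 - a.2) * (w.1 - a.1) - (b.1 - a.1) * (w.2 - a.2).

Lemma rside_segpt a b x y (t : R) :
  rside a b (segpt x y t) = (1 - t) * rside a b x + t * rside a b y.
Proof. rewrite /rside /segpt/=; ring. Qed.

Lemma rside_segment a b w : segment a b w -> rside a b w = 0.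
Proof. by move=> [t _ <-]; rewrite /rside /segpt/=; ring. Qed.

Lemma convex_gt0 (t p q : R) :
  0 <= t <= 1 -> 0 < p -> 0 < q -> 0 < (1 - t) * p + t * q.
Proof.
move=> /andP[t0 t1] p0 q0; case: (ltP t 1) => [t1'|t1'].
  by rewrite ltr_pwDl ?mulr_gt0 ?subr_gt0// mulr_ge0// ltW.
by rewrite ltr_wpDl ?mulr_ge0 ?subr_ge0 ?mulr_gt0 ?(lt_le_trans _ t1')// ltW.
Qed.

Lemma esq_segpt x (r : R) y z (t : R) : 0 <= t <= 1 ->
  esq x r y -> esq x r z -> esq x r (segpt y z t).
Proof.
have h (c u v : R) : 0 <= t <= 1 -> `|c - u| < r -> `|c - v| < r ->
    `|c - ((1 - t) * u + t * v)| < r.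
  move=> t01; rewrite !ltr_norml => /andP[u1 u2] /andP[v1 v2].
  have h1 : 0 < (1 - t) * (c - u + r) + t * (c - v + r).
    by apply: convex_gt0 => //; lra.
  have h2 : 0 < (1 - t) * (r - (c - u)) + t * (r - (c - v)).
    by apply: convex_gt0 => //; lra.
  by apply/andP; split; lra.
by move=> t01 [y1 y2] [z1 z2]; split; exact: h.
Qed.

(** Equal end points would make the starting points of the edges [i] and [ordS i] coincide, which
    simplicity excludes, as [i] and [ordS i] differ when [2 < N]. *)
Lemma polygon_edge_neq N (p : 'I_N -> R * R) D i : polygon p D ->
  p i <> p (ordS i).
Proof.
move=> P e; have /(_ i (ordS i) 0 0) [] := polygon_simple P.
- by rewrite lexx ltr01.
- by rewrite lexx ltr01.
- by rewrite /segpt !subr0 !mul1r !mul0r !addr0 -e.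
move=> /(congr1 val)/= + _; have := ltn_ord i; have := polygon_size P.
move=> N2 iN; case: (ltnP i.+1 N) => h.
  by rewrite modn_small//; lia.
have -> : i.+1 = N by apply/eqP; rewrite eqn_leq h iN.
by rewrite modnn; lia.
Qed.

Lemma dist2_gt0 a b : a <> b -> 0 < dist2 a b.
Proof.
move=> ab; rewrite sqrtr_gt0 lt_neqAle eq_sym addr_ge0 ?sqr_ge0// andbT.
rewrite paddr_eq0 ?sqr_ge0// !sqrf_eq0 !subr_eq0.
apply/negP => /andP[/eqP h1 /eqP h2]; apply: ab.
by case: a b h1 h2 => ? ? [? ?] /= -> ->.
Qed.

Lemma dist2_sqr a b : dist2 a b ^+ 2 = (a.1 - b.1) ^+ 2 + (a.2 - b.2) ^+ 2.
Proof. by rewrite sqr_sqrtr// addr_ge0 ?sqr_ge0. Qed.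

Lemma polygon_closed N (p : 'I_N -> R * R) D : polygon p D -> closed D.
Proof. by move=> P; rewrite (polygon_regular P); exact: closed_closure. Qed.

Lemma polygon_edge_frontier N (p : 'I_N -> R * R) D i w : polygon p D ->
  segment (p i) (p (ordS i)) w -> frontier D w.
Proof. by move=> P s; rewrite (polygon_frontier P); exists i. Qed.

Lemma polygon_edge_sub N (p : 'I_N -> R * R) D i w : polygon p D ->
  segment (p i) (p (ordS i)) w -> D w.
Proof.
move=> P /(polygon_edge_frontier P)[+ _].
by move: (polygon_closed P) => /closure_id {2}->.
Qed.

(** The other edges are closed, finitely many, and miss the inner point [X] by simplicity, so a
    whole square around [X] avoids them. *)
Lemma polygon_edge_isolated N (p : 'I_N -> R * R) D i (t : R) : polygon p D ->
  0 < t < 1 -> exists2 r : R, 0 < r &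
    forall w, esq (segpt (p i) (p (ordS i)) t) r w -> frontier D w ->
    rside (p i) (p (ordS i)) w = 0.
Proof.
move=> P /andP[t0 t1]; set X := segpt _ _ _.
have h j : j != i -> nbhs X (~` segment (p j) (p (ordS j))).
  move=> ji; apply: open_nbhs_nbhs; split.
    by apply: closed_openC; exact: segment_closed.
  (* [polygon_simple] covers parameters below 1 only, so the end point of edge [j] is treated as the
     start of edge [ordS j]. *)
  move=> [s]; rewrite /= in_itv/= => /andP[s0]; rewrite le_eqVlt.
  move=> /predU1P[->|s1] e.
    have := polygon_simple P (i := ordS j) (j := i) (s := 0) (t := t).
    rewrite lexx ltr01 t1 (ltW t0) segpt0 -/X -e segpt1 => /(_ erefl erefl erefl).
    by move=> [_ t0']; move: t0; rewrite -t0' ltxx.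
  have := polygon_simple P (i := j) (j := i) (s := s) (t := t).
  rewrite s0 s1 t1 (ltW t0) => /(_ erefl erefl e)[jiE _].
  by rewrite jiE eqxx in ji.
have : nbhs X (fun w => forall j, j != i -> ~ segment (p j) (p (ordS j)) w).
  have : forall j, nbhs X (fun w => j != i -> ~ segment (p j) (p (ordS j)) w).
    move=> j; have [ji|/h hj] := eqVneq j i; first by apply/nbhs_esq; exists 1.
    by apply: (@filterS _ (nbhs X)) hj => w + _.
  exact: (@filter_forall _ _ _ (nbhs X)).
move=> /nbhs_esq[r r0 hr]; exists r => // w /hr{}hr.
rewrite (polygon_frontier P) => -[j _ jw].
have [ji|ji] := eqVneq j i; last by case: (hr _ ji).
by apply: rside_segment; rewrite -ji.
Qed.

End PolygonBoundary.

Section PolygonSides.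
Variable R : realType.
Implicit Types (a b x y z w : R * R) (D : set (R * R)).

Lemma esq_ray x w (r : R) : 0 < r -> exists2 d : R, 0 < d &
  forall e, 0 <= e < d -> esq x r (x.1 + e * w.1, x.2 + e * w.2).
Proof.
(* The summand 1 keeps [m] positive when [w] vanishes. *)
move=> r0; set m := `|w.1| + `|w.2| + 1.
have m0 : 0 < m by rewrite ltr_wpDl ?addr_ge0.
exists (r / m); first by rewrite divr_gt0.
move=> e /andP[e0]; rewrite ltr_pdivlMr// => er.
have h (c u : R) : `|u| <= m -> `|c - (c + e * u)| < r.
  move=> um; rewrite opprD addNKr normrN normrM (ger0_norm e0).
  by apply: le_lt_trans er; rewrite ler_wpM2l.
by split; apply: h; rewrite /m; have := normr_ge0 w.1; have := normr_ge0 w.2; lra.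
Qed.

Lemma rside_ray a b x w (e : R) :
  rside a b (x.1 + e * w.1, x.2 + e * w.2) =
  rside a b x + e * ((b.2 - a.2) * w.1 - (b.1 - a.1) * w.2).
Proof. rewrite /rside/=; ring. Qed.

(** Inside a small square, frontier points lie only on the line of the edge, so membership in [D] is
    constant on each open half. [polygon_ccw] puts the right half outside, and regularity then puts
    the left half inside. *)
Lemma polygon_local N (p : 'I_N -> R * R) D i (t : R) : polygon p D ->
  0 < t < 1 -> exists2 r : R, 0 < r &
    forall w, esq (segpt (p i) (p (ordS i)) t) r w ->
    rside (p i) (p (ordS i)) w != 0 ->
    (D w <-> rside (p i) (p (ordS i)) w < 0).
Proof.
move=> P t01; have [r r0 hr] := polygon_edge_isolated i P t01.
set a := p i; set b := p (ordS i); set X := segpt a b t.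
have d0 : 0 < dist2 a b by apply: dist2_gt0; exact: polygon_edge_neq P.
have XS : segment a b X.
  by case/andP: t01 => t0 t1; exists t => //=; rewrite in_itv/= !ltW.
have X0 : rside a b X = 0 by exact: rside_segment.
(* [c] is 1 for the right half of the square and -1 for the left half. *)
have conv (u v : R * R) (c : R) : c != 0 -> esq X r u -> esq X r v ->
    0 < c * rside a b u -> 0 < c * rside a b v -> D u -> D v.
  move=> c0 uX vX u0 v0 Du; apply: contrapT => Dv.
  have [s s01 /hr] := segment_cross_frontier Du Dv.
  move=> /(_ (esq_segpt s01 uX vX)); rewrite rside_segpt => e.
  have := convex_gt0 s01 u0 v0.
  by rewrite !(mulrCA _ c) -mulrDr e mulr0 ltxx.
have [y [yX y0 Dy]] : exists y, [/\ esq X r y, 0 < rside a b y & ~ D y].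
  have [d dpos hd] := esq_ray X (rnormal a b) r0.
  have := polygon_ccw P i t01; rewrite -/a -/b -/X => /= out.
  have hd' : \forall e \near 0^'+, 0 < e /\ e < d.
    by apply: filterI; [exact: nbhs_right_gt|exact: nbhs_right_lt].
  have [e [[e0 ed] De]] := filter_ex (filterI hd' out).
  exists (X.1 + e * (rnormal a b).1, X.2 + e * (rnormal a b).2).
  split=> //; first by apply: hd; rewrite (ltW e0) ed.
  rewrite rside_ray X0 add0r mulr_gt0// /rnormal/=.
  rewrite !mulrA mulrN mulNr opprK -mulrDl divr_gt0//.
  have := dist2_sqr a b; have : 0 < dist2 a b ^+ 2 by rewrite exprn_gt0.
  by move=> h1 h2; move: h1; rewrite h2; lra.
exists r => // w wX w0; split=> [Dw|wneg].
  rewrite ltNge le_eqVlt eq_sym (negbTE w0)/=; apply/negP => wpos.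
  by apply: Dy; apply: (conv w y 1); rewrite ?oner_eq0// mul1r.
(* If a point on the left were outside [D], then near [X] the region would be
   contained in the line, against [D = closure D°]. *)
apply: contrapT => Dw.
have offD z : esq X r z -> rside a b z != 0 -> ~ D z.
  move=> zX; rewrite neq_lt => /orP[z0|z0] Dz.
    apply: Dw; apply: (conv z w (- 1));
      by rewrite ?mulN1r ?oppr_gt0 ?oppr_eq0 ?oner_eq0.
  by apply: Dy; apply: (conv z y 1); rewrite ?oner_eq0// mul1r.
have : D X by apply: (polygon_edge_sub P XS).
rewrite {1}(polygon_regular P) => /(_ (esq X r)) [].
  by apply/nbhs_esq; exists r.
move=> z [Dz zX].
(* [z] is an interior point of [D] near [X]. Off the line it contradicts [offD]; on the line, a
   small move along the normal leaves the line without leaving [D]. *)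
have [z0|z0] := eqVneq (rside a b z) 0; last first.
  by apply: (offD z) => //; exact: interior_subset Dz.
have : nbhs z (D `&` esq X r).
  apply: filterI => //; apply/nbhs_esq.
  case: zX => z1 z2.
  exists (Num.min (r - `|X.1 - z.1|) (r - `|X.2 - z.2|)).
    by rewrite lt_min !subr_gt0 z1.
  move=> v; rewrite /esq/= !lt_min => -[/andP[v1 _] /andP[_ v2]]; split.
    by have := ler_distD z.1 X.1 v.1; lra.
  by have := ler_distD z.2 X.2 v.2; lra.
move=> /nbhs_esq[q q0 hq].
have [d dpos hd] := esq_ray z (rnormal a b) q0.
have [|Dv vX] := hq _ (hd (d / 2) _); first by apply/andP; split; lra.
move: Dv; apply: offD => //.
rewrite rside_ray z0 add0r mulf_neq0//; first by apply/eqP; lra.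
rewrite /rnormal/= !mulrA mulrN mulNr opprK -mulrDl gt_eqF// divr_gt0//.
have := dist2_sqr a b; have : 0 < dist2 a b ^+ 2 by rewrite exprn_gt0.
by move=> h1 h2; move: h1; rewrite h2; lra.
Qed.

End PolygonSides.

(** * Regions bounded by edges, and exchange of the axes *)

Section EdgeRegion.
Variable R : realType.
Implicit Types (x y z w : R * R) (D : set (R * R)).

(* [D] lies on one side of each of its edges: on the left if [s = 1] and on the
   right if [s = -1].  Unlike [polygon], this is stable under [swap]. *)
Record edge_region (I : finType) (a b : I -> R * R) (s : R) D : Prop :=
  EdgeRegion {
  er_sign : s = 1 \/ s = - 1;
  er_closed : closed D;
  er_bounded : exists r : R, forall x, D x -> `|x.1| <= r /\ `|x.2| <= r;
  er_off : forall z, (forall i, ~ segment (a i) (b i) z) ->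
    exists2 r : R, 0 < r & forall w, esq z r w -> (D w <-> D z);
  er_inj : forall (i j : I) (t u : R), 0 < t < 1 -> 0 < u < 1 ->
    segpt (a i) (b i) t = segpt (a j) (b j) u -> i = j;
  er_side : forall (i : I) (t : R), 0 < t < 1 -> exists2 r : R, 0 < r &
    forall w, esq (segpt (a i) (b i) t) r w -> rside (a i) (b i) w != 0 ->
    (D w <-> s * rside (a i) (b i) w < 0)
}.

Lemma dist2_ge x y : `|x.1 - y.1| <= dist2 x y /\ `|x.2 - y.2| <= dist2 x y.
Proof.
by split; rewrite -sqrtr_sqr ler_sqrt ?addr_ge0 ?sqr_ge0// ?lerDl ?lerDr sqr_ge0.
Qed.

Lemma polygon_coord_bounded N (p : 'I_N -> R * R) D : polygon p D ->
  exists r : R, forall x, D x -> `|x.1| <= r /\ `|x.2| <= r.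
Proof.
move=> P; have [r hr] := polygon_bounded P.
have [[x0 Dx0]|/nonemptyPn D0] := pselect (D !=set0); last first.
  by exists 0 => x; rewrite D0.
exists (`|x0.1| + `|x0.2| + r) => x Dx; have := hr _ _ Dx Dx0.
have [h1 h2] := dist2_ge x x0 => h.
have := ler_normD (x.1 - x0.1) x0.1; have := ler_normD (x.2 - x0.2) x0.2.
by rewrite !subrK; have := normr_ge0 x0.1; have := normr_ge0 x0.2; split; lra.
Qed.

Lemma polygon_region N (p : 'I_N -> R * R) D : polygon p D ->
  edge_region p (fun i => p (ordS i)) 1 D.
Proof.
move=> P; split.
- by left.
- exact: polygon_closed P.
- exact: polygon_coord_bounded P.
- move=> z zP; have nF : ~ frontier D z.
    by rewrite (polygon_frontier P) => -[i _]; exact: zP.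
  have [Dz|Dz] := pselect (D z).
    have : nbhs z D°.
      apply: open_nbhs_nbhs; split; first exact: open_interior.
      by apply: contrapT => h; apply: nF; split=> //; exact: subset_closure.
    move=> /nbhs_esq[r r0 hr]; exists r => // w /hr Dw.
    by split=> // _; exact: interior_subset Dw.
  have : nbhs z (~` D).
    apply: open_nbhs_nbhs; split=> //.
    exact: closed_openC (polygon_closed P).
  by move=> /nbhs_esq[r r0 hr]; exists r => // w /hr Dw; split=> // /Dw.
- move=> i j t u /andP[t0 t1] /andP[u0 u1] e.
  by have [] // := polygon_simple P (i := i) (j := j) (s := t) (t := u);
    rewrite ?(ltW t0) ?(ltW u0).
- by move=> i t t01; have [r r0 hr] := polygon_local i P t01; exists r => // w;
    rewrite mul1r; exact: hr.
Qed.

Definition swap x : R * R := (x.2, x.1).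

Lemma swapK : involutive swap. Proof. by case. Qed.

Lemma swap_continuous : continuous swap.
Proof. by apply: pair_continuous => -[u v]; [exact: cvg_snd|exact: cvg_fst]. Qed.

Lemma segpt_swap x y (t : R) : segpt (swap x) (swap y) t = swap (segpt x y t).
Proof. by []. Qed.

(** Exchanging the axes reverses orientation: [rside] changes sign, and with it the side on which
    the region lies. *)
Lemma swap_region (I : finType) (a b : I -> R * R) (s : R) D :
  edge_region a b s D ->
  edge_region (swap \o a) (swap \o b) (- s) (swap @^-1` D).
Proof.
have rs x y w : rside (swap x) (swap y) w = - rside x y (swap w).
  by rewrite /rside /swap/=; ring.
have es x (r : R) w : esq (swap x) r w -> esq x r (swap w) by move=> [].
move=> [sg cD [r bD] off inj side]; split.
- by case: sg => ->; [right|left; rewrite opprK].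
- by apply: closed_comp cD => ? _; exact: swap_continuous.
- by exists r => x /bD[].
- move=> z zP; have [i|q q0 hq] := off (swap z).
    by move=> [t t01 e]; apply: (zP i); exists t => //=; rewrite segpt_swap e swapK.
  by exists q => // w zw; apply: hq; apply: es; rewrite swapK.
- move=> i j t u t01 u01 /=; rewrite !segpt_swap => /(congr1 swap).
  by rewrite !swapK; exact: inj.
- move=> i t t01; have [q q0 hq] := side i t t01; exists q => // w zw.
  rewrite /= rs oppr_eq0 mulrNN; apply: hq; exact: es.
Qed.

End EdgeRegion.

(** * The divergence theorem on polygons *)

Section Crossings.
Variable R : realType.

Lemma punctured_open (P : set R) :
  open [set z : R | exists2 r : R, 0 < r &
    forall w, `|z - w| < r -> w != z -> P w].
Proof.
rewrite openE => z [r r0 hr]; apply/nbhs_ballP; exists r => //= y zy.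
have [<-|yz] := eqVneq z y; first by exists r.
(* The second bound keeps [z] itself out of the ball around [y]. *)
exists (Num.min (r - `|z - y|) `|z - y|).
  by rewrite lt_min subr_gt0 zy normr_gt0 subr_eq0.
move=> w; rewrite lt_min => /andP[w1 w2] wy; apply: hr.
  by have := ler_distD y z w; lra.
by apply: contraTneq w2 => ->; rewrite distrC ltxx.
Qed.

(* A function that is constant on a punctured neighbourhood of every point
   takes the same constant everywhere, since the line is connected. *)
Lemma punctured_locally_constant (f : R -> R) (c d : R) (x y : R) :
  (forall z, exists c : R, exists2 r : R, 0 < r &
     forall w, `|z - w| < r -> w != z -> f w = c) ->
  (exists2 r : R, 0 < r & forall w, `|x - w| < r -> w != x -> f w = c) ->
  (exists2 r : R, 0 < r & forall w, `|y - w| < r -> w != y -> f w = d) ->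
  c = d.
Proof.
(* [A] and [B] are open and complementary, so [A] is clopen; it contains [x], hence also [y]. *)
move=> loc hx [q q0 hq].
pose A := [set z : R | exists2 r : R, 0 < r &
  forall w, `|z - w| < r -> w != z -> f w = c].
pose B := [set z : R | exists2 r : R, 0 < r &
  forall w, `|z - w| < r -> w != z -> f w <> c].
have inner (z r r' : R) : 0 < r -> 0 < r' ->
    exists w, [/\ `|z - w| < r, `|z - w| < r' & w != z].
  move=> r0 r'0; exists (z + Num.min r r' / 2).
  have m0 : 0 < Num.min r r' by rewrite lt_min r0.
  have m1 : Num.min r r' <= r by rewrite ge_min lexx.
  have m2 : Num.min r r' <= r' by rewrite ge_min lexx orbT.
  rewrite opprD addNKr normrN gtr0_norm ?divr_gt0//.
  by split; [lra|lra|rewrite gt_eqF//; lra].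
have AB : ~` A = B.
  apply/seteqP; split=> [z nA|z [r r0 hr] [r' r'0 hr']].
    have [e [r r0 hr]] := loc z.
    exists r => // w zw wz; rewrite (hr w zw wz) => ec; apply: nA.
    by exists r => // v zv vz; rewrite (hr v).
  by have [w [/hr h1 /hr' h2 wz]] := inner z _ _ r0 r'0; apply: h1; rewrite ?h2.
have oA : open A by exact: punctured_open.
have cA : closed A.
  by rewrite -[A]setCK AB; apply: open_closedC; exact: punctured_open.
have /connected_intervalP/(_ A) : is_interval [set: R] by [].
move=> AT; have [r r0 hr] : A y.
  by rewrite AT//; [exists x|exists A; rewrite ?setTI|exists A; rewrite ?setTI].
have [w [/hr + /hq + wy]] := inner y _ _ r0 q0.
by move=> /(_ wy) <- /(_ wy).
Qed.

Lemma finite_min_pos (I : finType) (A : pred I) (P : I -> R -> Prop) :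
  (forall i (r r' : R), P i r -> r' <= r -> P i r') ->
  (forall i, A i -> exists2 r : R, 0 < r & P i r) ->
  exists2 r : R, 0 < r & forall i, A i -> P i r.
Proof.
move=> mono h.
have /choice[f hf] : forall i, exists r : R, 0 < r /\ (A i -> P i r).
  by move=> i; have [/h[r r0 Pr]|_] := boolP (A i); [exists r|exists 1].
exists (\big[Num.min/1]_i f i).
  by elim/big_ind: _ => // [u v u0 v0|i _]; [rewrite lt_min u0|case: (hf i)].
move=> i Ai; have [_ /(_ Ai) Pi] := hf i; apply: mono Pi _.
by rewrite (bigD1 i)//= ge_min lexx.
Qed.

(* Both sides vanish to the right of [E], and their difference is locally
   constant: at a crossing [x i] the two jumps cancel, [E] being on the left of
   [x i] if [s i = 1] and on its right if [s i = -1]. *)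
Lemma indic_crossings (I : finType) (E : set R) (A : pred I) (x s : I -> R)
    (M : R) :
  (forall z, E z -> `|z| <= M) ->
  (forall z, (forall i, A i -> z <> x i) ->
     exists2 r : R, 0 < r & forall w, `|z - w| < r -> (E w <-> E z)) ->
  (forall i j, A i -> A j -> x i = x j -> i = j) ->
  (forall i, A i -> s i = 1 \/ s i = - 1) ->
  (forall i, A i -> exists2 r : R, 0 < r &
     forall w, `|x i - w| < r -> w != x i -> (E w <-> 0 < s i * (x i - w))) ->
  forall z, (forall i, A i -> z <> x i) ->
    \1_E z = \sum_(i | A i) s i * (z < x i)%R%:R.
Proof.
move=> bE off inj sgn side.
pose S (B : pred I) z : R := \sum_(i | B i) s i * (z < x i)%R%:R.
have Sloc (B : pred I) z : (forall i, B i -> z <> x i) ->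
    exists2 r : R, 0 < r & forall w, `|z - w| < r -> S B w = S B z.
  move=> zB; have [||r r0 hr] := @finite_min_pos I B (fun i r =>
      forall w, `|z - w| < r -> (w < x i) = (z < x i)).
  - by move=> i r r' h rr' w wr; apply: h; exact: lt_le_trans rr'.
  - move=> i /zB/eqP zi; exists `|z - x i|; first by rewrite normr_gt0 subr_eq0.
    move=> w; have [] := ltP z (x i) => h.
      rewrite ltr_norml (ltr0_norm (x := z - x i)) ?subr_lt0// => /andP[h1 h2].
      by apply/idP; lra.
    rewrite ltr_norml (ger0_norm (x := z - x i)) ?subr_ge0// => /andP[h1 h2].
    by apply/negbTE; rewrite -leNgt; lra.
  - by exists r => // w wr; apply: eq_bigr => i Bi; rewrite (hr i Bi).
pose f z : R := \1_E z - S A z.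
have indE (w : R) (b : bool) : (E w <-> b) -> \1_E w = b%:R :> R.
  rewrite indicE => h; congr (_%:R); congr nat_of_bool.
  by apply/idP/idP; rewrite inE => /h.
have floc z : (forall i, A i -> z <> x i) ->
    exists2 r : R, 0 < r & forall w, `|z - w| < r -> f w = f z.
  move=> zA; have [r r0 hr] := off z zA; have [q q0 hq] := Sloc A z zA.
  exists (Num.min r q); first by rewrite lt_min r0.
  move=> w; rewrite lt_min => /andP[/hr h1 /hq h2]; rewrite /f h2; congr (_ - _).
  by apply: indE; rewrite h1 inE.
have fpunct z : exists c : R, exists2 r : R, 0 < r &
    forall w, `|z - w| < r -> w != z -> f w = c.
  have [[i [Ai zi]]|nc] := pselect (exists i, A i /\ z = x i); last first.
    have [i Ai zi|r r0 hr] := floc z; first by apply: nc; exists i.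
    by exists (f z), r => // w /hr.
  have [r r0 hr] := side i Ai.
  have [j /andP[Aj ji] zj|q q0 hq] := Sloc [pred j | A j && (j != i)] z.
    by move/eqP: ji; apply; apply: inj => //; rewrite -zj.
  (* For [s i = 1] the indicator of [E] and the step at [x i] agree and cancel; for [s i = -1] they
     are complementary and add up to 1. *)
  exists ((s i < 0)%R%:R - S [pred j | A j && (j != i)] z), (Num.min r q).
    by rewrite lt_min r0.
  move=> w; rewrite lt_min => /andP[zr /hq zq] wz.
  rewrite /f /S (bigD1 i)//= -/(S [pred j | A j && (j != i)] w) zq opprD addrA.
  congr (_ - _); rewrite zi in zr wz; rewrite (indE _ _ (hr w zr wz)).
  have [si|si] := sgn i Ai; rewrite si.
    by rewrite !mul1r subr_gt0 subrr ltr10.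
  rewrite !mulN1r oppr_gt0 subr_lt0 opprK ltrN10.
  by have [] := ltrgtP w (x i) => h; rewrite ?addr0 ?add0r//; rewrite h eqxx in wz.
move=> z zA; have [r r0 hr] := floc z zA.
(* [K] lies to the right of [E] and of all crossings, so [f] vanishes on the ball of radius 1 around
   [K + 1]. *)
pose K := \big[Num.max/M + 1]_i (x i + 1).
have KM : M + 1 <= K by exact: bigmax_ge_id.
have Kx i : x i + 1 <= K by rewrite /K (bigD1 i)//= le_max lexx.
suff : f z = 0 by move=> /eqP; rewrite subr_eq0 => /eqP.
apply: (@punctured_locally_constant f _ _ z (K + 1)) => //.
  by exists r => // w /hr.
exists 1 => // w; rewrite ltr_norml => /andP[w1 w2] _.
rewrite /f /S big1 ?subr0.
  rewrite indicE memNset// => /bE; have := ler_norm w; lra.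
by move=> i Ai; have := Kx i; case: ltP => [h h'|]; [lra|rewrite mulr0].
Qed.

End Crossings.

(** * Integration over one-dimensional slices *)

Section Slice.
Variable R : realType.
Notation mu := (@lebesgue_measure R).

Lemma continuous_itv_integrable (f : R -> R) (a b : R) : continuous f ->
  mu.-integrable `[a, b] (EFin \o f).
Proof.
move=> cf; apply: continuous_compact_integrable; first exact: segment_compact.
exact: continuous_subspaceT.
Qed.

Lemma integral_primitive (f F : R -> R) (a b : R) : a <= b -> continuous f ->
  (forall x, is_derive x (1 : R) F (f x)) ->
  (\int[mu]_(x in `[a, b]) (f x)%:E = (F b - F a)%:E)%E.
Proof.
rewrite le_eqVlt => /predU1P[->|ab] cf dF.
  by rewrite subrr set_itv1 integral_set1.
have cF : continuous F.
  by move=> x; apply/differentiable_continuous/derivable1_diffP; case: (dF x).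
rewrite (@continuous_FTC2 _ f F)// ?EFinB//.
- exact: continuous_subspaceT.
- split=> [x _||]; first by case: (dF x).
    by apply: cvg_at_right_filter; exact: cF.
  by apply: cvg_at_left_filter; exact: cF.
- by move=> x _; rewrite derive1E; case: (dF x).
Qed.

Lemma integral_eq_off_finite (N : set R) (f g : R -> \bar R) : finite_set N ->
  measurable_fun setT f -> measurable_fun setT g ->
  (forall x, ~ N x -> f x = g x) ->
  (\int[mu]_x f x = \int[mu]_x g x)%E.
Proof.
move=> fN mf mg fg; apply: ae_eq_integral => //.
exists N; split.
- exact: countable_measurable (finite_set_countable fN).
- exact: countable_lebesgue_measure0 (finite_set_countable fN).
by move=> x /= h; apply: contrapT => /fg e; apply: h => _; rewrite e.
Qed.

(** Integrating the signed count term by term from a point [K] far on the left gives the terms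
    [s i * (F (x i) - F K)]. The signs add up to 0 because the indicator vanishes at [K], so [F K]
    drops out. *)
Lemma integral_crossings (I : finType) (E : set R) (A : pred I) (x s : I -> R)
    (M : R) (f F : R -> R) :
  measurable E -> continuous f ->
  (forall z, is_derive z (1 : R) F (f z)) ->
  (forall z, E z -> `|z| <= M) ->
  (forall z, (forall i, A i -> z <> x i) ->
    \1_E z = \sum_(i | A i) s i * (z < x i)%R%:R) ->
  (\int[mu]_z (\1_E z * f z)%:E = (\sum_(i | A i) s i * F (x i))%:E)%E.
Proof.
move=> mE cf dF bE ind.
pose K := \big[Num.min/- M - 1]_i (x i - 1).
have KM : K <= - M - 1 by exact: bigmin_le_id.
have Kx i : K < x i.
  by rewrite (@le_lt_trans _ _ (x i - 1))// ?gtrBl// /K (bigD1 i)//= ge_min lexx.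
have nE z : z <= K -> \1_E z = 0 :> R.
  move=> zK; rewrite indicE memNset// => /bE.
  by rewrite ler_norml => /andP[h _]; lra.
have s0 : \sum_(i | A i) s i = 0.
  have := ind K; rewrite nE// => h; rewrite [RHS]h; last first.
    by move=> i _ e; have := Kx i; rewrite e ltxx.
  by apply: eq_bigr => i _; rewrite Kx mulr1.
have Ei i : (\int[mu]_z (\1_(`[K, x i]) z * f z)%:E = (F (x i) - F K)%:E)%E.
  rewrite -(integral_primitive (ltW (Kx i)) cf dF) [RHS]integral_mkcond.
  apply: eq_integral => z _; rewrite patchE indicE.
  by case: ifPn => _; rewrite ?mul1r ?mul0r.
have fi i : mu.-integrable setT (fun z => (\1_(`[K, x i]) z * f z)%:E).
  have /(integrable_restrict mu (measurable_itv _) measurableT) :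
      mu.-integrable ([set: R] `&` `[K, x i]) (EFin \o f).
    by rewrite setTI; exact: continuous_itv_integrable.
  congr (integrable _ _ _); apply/funext => z.
  by rewrite patchE indicE; case: ifPn => _; rewrite ?mul1r ?mul0r.
have mi i : mu.-integrable setT (fun z => (s i * (\1_(`[K, x i]) z * f z))%:E).
  have := integrableZl measurableT (s i) (fi i).
  by congr (integrable _ _ _); apply/funext => z; rewrite [in RHS]EFinM.
pose g z := \sum_(i | A i) s i * (\1_(`[K, x i]) z * f z).
have mg : measurable_fun setT (EFin \o g).
  rewrite /g /comp/=; under eq_fun do rewrite -sumEFin.
  apply: (measurable_int mu); apply: (integrable_sum measurableT) => i _.
  exact: mi.
(* At a crossing, the closed interval and the strict inequality disagree; finitely many points do
   not affect the integral. *)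
have fin : finite_set (range x `|` [set K]).
  by rewrite finite_setU; split; [exact: finite_image|exact: finite_set1].
rewrite (integral_eq_off_finite fin _ mg); last 2 first.
- apply/measurable_EFinP; apply: measurable_funM; 
    [exact: measurable_indic|exact: continuous_measurable_fun].
- move=> z zx; have zA i : A i -> z <> x i.
    by move=> _ e; apply: zx; left; exists i.
  rewrite /= /g; congr EFin; have [zK|Kz] := ltrP z K.
    rewrite nE ?ltW// mul0r big1// => i _; rewrite indicE memNset ?mul0r ?mulr0//.
    by rewrite /= in_itv/= leNgt zK.
  rewrite ind// mulr_suml; apply: eq_bigr => i Ai; rewrite -mulrA indicE.
  congr (_ * (_ * _)); congr (_%:R); congr nat_of_bool.
  rewrite mem_setE in_itv/= Kz/= le_eqVlt.
  by have /eqP/negbTE-> := zA i Ai.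
rewrite /g /=; under eq_integral do rewrite -sumEFin.
rewrite integral_sum// -sumEFin.
transitivity (\sum_(i | A i) ((s i)%:E * (F (x i) - F K)%:E))%E.
  apply: eq_bigr => i Ai; rewrite -Ei -integralZl//.
under eq_bigr do rewrite -EFinM.
rewrite !sumEFin; congr (_%:E).
under eq_bigr do rewrite mulrBr.
by rewrite sumrB -mulr_suml s0 mul0r subr0.
Qed.

End Slice.

(** * Measurability and integrability in the plane *)

Section Plane.
Variable R : realType.
Notation mu := (@lebesgue_measure R).
Implicit Types (D : set (R * R)) (f g : R * R -> R).

Lemma esq_setX (x : R * R) (r : R) :
  esq x r = `]x.1 - r, x.1 + r[ `*` `]x.2 - r, x.2 + r[.
Proof.
apply/seteqP; split=> -[u v]; rewrite /esq /= !in_itv/= !ltr_norml.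
  by move=> [/andP[h1 h2] /andP[h3 h4]]; split; apply/andP; split; lra.
by move=> [/andP[h1 h2] /andP[h3 h4]]; split; apply/andP; split; lra.
Qed.

Lemma measurable_esq (x : R * R) (r : R) : measurable (esq x r).
Proof. by rewrite esq_setX; apply: measurableX; exact: measurable_itv. Qed.

(** An open set is a countable union of squares with rational centres and radii. *)
Lemma open_measurable2 D : open D -> measurable D.
Proof.
move=> oD.
pose B (p q r : rat) := if `[< esq (ratr p, ratr q) (ratr r) `<=` D >]
  then esq (ratr p, ratr q) (ratr r) else (set0 : set (R * R)).
have -> : D = \bigcup_p \bigcup_q \bigcup_r B p q r.
  apply/seteqP; split=> [x Dx|x [p _ [q _ [r _]]]]; last first.
    by rewrite /B; case: asboolP => // h /h.
  have : nbhs x D by apply: open_nbhs_nbhs.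
  move=> /nbhs_esq[e e0 he].
  (* A radius below [e / 2] keeps every such square that contains [x] inside [esq x e]. *)
  have [r] : exists r : rat, ratr r \in `]0, e / 2[.
    by apply: rat_in_itvoo; lra.
  rewrite in_itv/= => /andP[r0 re].
  have [p] : exists p : rat, ratr p \in `]x.1 - ratr r, x.1 + ratr r[.
    by apply: rat_in_itvoo; lra.
  rewrite in_itv/= => /andP[p1 p2].
  have [q] : exists q : rat, ratr q \in `]x.2 - ratr r, x.2 + ratr r[.
    by apply: rat_in_itvoo; lra.
  rewrite in_itv/= => /andP[q1 q2].
  exists p => //; exists q => //; exists r => //.
  rewrite /B asboolT.
    by split; rewrite /= ltr_norml; apply/andP; split; lra.
  move=> w [/=]; rewrite !ltr_norml => /andP[h1 h2] /andP[h3 h4]; apply: he.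
  by split; rewrite ltr_norml; apply/andP; split; lra.
apply: bigcupT_measurable_rat => p; apply: bigcupT_measurable_rat => q.
apply: bigcupT_measurable_rat => r; rewrite /B; case: ifP => _ //.
exact: measurable_esq.
Qed.

Lemma closed_measurable2 D : closed D -> measurable D.
Proof.
by move=> /closed_openC/open_measurable2/measurableC; rewrite setCK.
Qed.

Lemma continuous_measurable2 f : continuous f -> measurable_fun setT f.
Proof.
move=> /continuousP cf; apply: (measurability _ (RGenOpens.measurableE R)).
move=> _ [_ [a [b ->] <-]]; rewrite setTI; apply: open_measurable2.
exact/cf/interval_open.
Qed.

(** [D] is compact, so it has finite measure and [f] is bounded on it. *)
Lemma continuous_integrable2 D f : closed D ->
  (exists r : R, forall x, D x -> `|x.1| <= r /\ `|x.2| <= r) ->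
  continuous f -> (@leb2 R).-integrable D (EFin \o f).
Proof.
move=> cD [r bD] cf; pose Q : set (R * R) := `[- r, r] `*` `[- r, r].
have DQ : D `<=` Q.
  move=> x /bD[]; rewrite !ler_norml => /andP[h1 h2] /andP[h3 h4].
  by split; rewrite /= in_itv/=; apply/andP.
have kQ : compact Q by apply: compact_setX; exact: segment_compact.
have kD : compact D by exact: subclosed_compact cD kQ DQ.
have mD := closed_measurable2 cD.
apply: measurable_bounded_integrable => //.
- have : (leb2 D <= leb2 Q)%E.
    apply: le_measure; rewrite ?inE//.
    by apply: measurableX; exact: measurable_itv.
  move=> /le_lt_trans; apply; rewrite /leb2 /Q product_measure1E//.
  have h : (mu `[(- r)%R, r] < +oo)%E.
    by rewrite lebesgue_measure_itv; case: ifP => _; rewrite ltry.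
  by rewrite lte_mul_pinfty// ge0_fin_numE.
- by apply: measurable_funTS; exact: continuous_measurable2.
- have /compact_bounded[M [_ hM]] : compact (f @` D).
    by apply: continuous_compact kD; exact: continuous_subspaceT.
  by exists M; split; rewrite ?num_real// => M' MM' x Dx; apply: hM => //; exists x.
Qed.

End Plane.

(** * Edges parametrised by height *)

Section EdgeIntegral.
Variable R : realType.
Notation mu := (@lebesgue_measure R).
Implicit Types (a b : R * R) (P : R * R -> R).

(* First coordinate of the point at height [y] of the line through [a], [b];
   the junk value for a horizontal line is [a.1]. *)
Definition line_x a b (y : R) : R :=
  a.1 + (y - a.2) / (b.2 - a.2) * (b.1 - a.1).

Lemma segpt_line_x a b (t : R) : a.2 != b.2 ->
  (line_x a b (a.2 + t * (b.2 - a.2)), a.2 + t * (b.2 - a.2)) = segpt a b t.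
Proof.
move=> ab; rewrite /line_x /segpt; congr pair; last by ring.
by field; rewrite subr_eq0 eq_sym.
Qed.

Lemma segptC a b (t : R) : segpt a b (1 - t) = segpt b a t.
Proof. by rewrite /segpt; congr pair; ring. Qed.

Lemma line_xC a b (y : R) : a.2 != b.2 -> line_x a b y = line_x b a y.
Proof.
by move=> ab; rewrite /line_x; field; rewrite !subr_eq0 ab eq_sym ab.
Qed.

Lemma line_x_continuous a b : continuous (line_x a b).
Proof.
move=> y; apply: cvgD; first exact: cvg_cst.
apply: cvgM; last exact: cvg_cst.
by apply: cvgM; [apply: cvgB; [exact: cvg_id|exact: cvg_cst]|exact: cvg_cst].
Qed.

(** Change of variables [y = a.2 + t * (b.2 - a.2)], under which [segpt a b t] is the point of the
    edge at height [y]. *)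
Lemma integral_up_edge a b P : continuous P -> a.2 < b.2 ->
  (\int[mu]_(y in `]a.2, b.2[) (P (line_x a b y, y))%:E =
   ((b.2 - a.2) * \int[mu]_(t in `[0, 1]) P (segpt a b t))%:E)%E.
Proof.
move=> cP ab; set c := b.2 - a.2; have c0 : 0 < c by rewrite subr_gt0.
pose F (t : R) : R := a.2 + t * c.
have dF (t : R) : is_derive t (1 : R) F c.
  have -> : F = horner (c *: 'X + a.2%:P).
    by apply/funext => u; rewrite /F !hornerE addrC mulrC.
  apply: is_derive_eq.
  by rewrite derivD derivZ derivX derivC !hornerE.
have cG : continuous (fun y => P (line_x a b y, y)).
  move=> y; apply: continuous_comp; last exact: cP.
  by apply: (pair_continuous (line_x_continuous (a:=a) (b:=b))) => ?; exact: cvg_id.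
have F0 : F 0 = a.2 by rewrite /F mul0r addr0.
have F1 : F 1 = b.2 by rewrite /F mul1r addrC subrK.
have dFE : (F^`())%classic = cst c.
  by apply/funext => t; rewrite derive1E; case: (dF t).
have cF : continuous F.
  by move=> t; apply/differentiable_continuous/derivable1_diffP; case: (dF t).
rewrite integral_itv_bndo_bndc ?integral_itv_obnd_cbnd; last 2 first.
- apply: measurable_funTS; apply/measurable_EFinP; exact: continuous_measurable_fun.
- apply: measurable_funTS; apply/measurable_EFinP; exact: continuous_measurable_fun.
rewrite -F0 -F1.
rewrite (@integration_by_substitution_increasing R F
  (fun y => P (line_x a b y, y)) 0 1)//; last 6 first.
- by move=> x y _ _ xy; rewrite /F ltrD2l ltr_pM2r.
- by rewrite dFE => ? _; exact: cvg_cst.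
- by rewrite dFE; exact: is_cvg_cst.
- by rewrite dFE; exact: is_cvg_cst.
- split=> [t _||]; first by case: (dF t).
    by apply: cvg_at_right_filter; exact: cF.
  by apply: cvg_at_left_filter; exact: cF.
- exact: continuous_subspaceT.
rewrite dFE -RintegralZl//; last first.
  apply: continuous_itv_integrable => t; apply: continuous_comp; last exact: cP.
  exact: segpt_continuous.
rewrite /Rintegral fineK.
  apply: eq_integral => t _ /=; rewrite fctE /= mulrC /F segpt_line_x//.
  by rewrite lt_eqF.
apply: integrable_fin_num => //; apply: continuous_itv_integrable => t.
apply: cvgM; first exact: cvg_cst.
apply: continuous_comp; last exact: cP.
exact: segpt_continuous.
Qed.

(** The height decreases along a descending edge, hence the sign; a horizontal edge contributes 0 to
    both sides. *)
Lemma integral_edge a b P : continuous P ->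
  (\int[mu]_y (((a.2 < y < b.2) || (b.2 < y < a.2))%:R *
      (Num.sg (b.2 - a.2) * P (line_x a b y, y)))%:E =
   ((b.2 - a.2) * \int[mu]_(t in `[0, 1]) P (segpt a b t))%:E)%E.
Proof.
move=> cP.
have up (Q : R * R -> R) (c d : R * R) : continuous Q -> c.2 < d.2 ->
    (\int[mu]_y (((c.2 < y < d.2) || (d.2 < y < c.2))%:R *
      Q (line_x c d y, y))%:E =
    ((d.2 - c.2) * \int[mu]_(t in `[0, 1]) Q (segpt c d t))%:E)%E.
  move=> cQ cd; rewrite -integral_up_edge// [RHS]integral_mkcond.
  apply: eq_integral => y _; rewrite patchE mem_setE in_itv/=.
  have -> : (d.2 < y < c.2) = false.
    by apply/negbTE/negP => /andP[h1 h2]; lra.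
  by rewrite orbF; case: ifP => _; rewrite ?mul1r ?mul0r.
have [ab|ba|ab] := ltgtP a.2 b.2.
- rewrite gtr0_sg ?subr_gt0//; under eq_integral do rewrite mul1r.
  exact: up.
(* A descending edge is the ascending edge from [b] to [a] with integrand [- P], up to the
   substitution of [1 - t] for [t]. *)
- have cN : continuous (fun x => - 1 * P x).
    by move=> x; apply: cvgM; [exact: cvg_cst|exact: cP].
  have := up _ _ _ cN ba.
  have cS : continuous (fun t : R => P (segpt a b t)).
    by move=> t; apply: continuous_comp; [exact: segpt_continuous|exact: cP].
  rewrite RintegralZl//; last first.
    apply: continuous_itv_integrable => t.
    by apply: continuous_comp; [exact: segpt_continuous|exact: cP].
  rewrite mulrA mulrN1 opprB ltr0_sg ?subr_lt0// => e.
  rewrite (@Rintegration_by_substitution_onem _ _ 1) ?lexx ?ler01//; last first.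
    exact: continuous_subspaceT.
  rewrite unstable.onem1 /unstable.onem; under eq_Rintegral do rewrite segptC.
  rewrite -e; apply: eq_integral => y _; rewrite orbC line_xC//.
  by rewrite gt_eqF.
- rewrite ab subrr sgr0 mul0r; under eq_integral do rewrite mul0r mulr0.
  by rewrite integral0.
Qed.

End EdgeIntegral.

(** * Horizontal sections of a region *)

Section Green.
Variable R : realType.
Notation mu := (@lebesgue_measure R).
Implicit Types (a b : R * R) (D : set (R * R)).

(** The strict inequalities exclude horizontal edges and crossings at a vertex, so that an active
    edge meets the horizontal line in a single inner point. *)
Definition edge_active (I : Type) (a b : I -> R * R) (y : R) : pred I :=
  fun i => ((a i).2 < y < (b i).2) || ((b i).2 < y < (a i).2).

Lemma edge_active_param (I : Type) (a b : I -> R * R) (y : R) i :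
  edge_active a b y i -> (a i).2 != (b i).2 /\
  exists2 t : R, 0 < t < 1 & segpt (a i) (b i) t = (line_x (a i) (b i) y, y).
Proof.
move=> Ai; have ne : (a i).2 != (b i).2.
  by case/orP: Ai => /andP[h1 h2]; rewrite neq_lt (lt_trans h1 h2)// orbT.
split=> //; exists ((y - (a i).2) / ((b i).2 - (a i).2)); last first.
  rewrite -segpt_line_x//; have -> //: (a i).2 +
    (y - (a i).2) / ((b i).2 - (a i).2) * ((b i).2 - (a i).2) = y.
  by field; rewrite subr_eq0 eq_sym.
case/orP: Ai => /andP[h1 h2].
  have d0 : 0 < (b i).2 - (a i).2 by lra.
  by apply/andP; split; [rewrite divr_gt0//; lra|rewrite ltr_pdivrMr// mul1r; lra].
have d0 : (b i).2 - (a i).2 < 0 by lra.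
apply/andP; split; first by rewrite nmulr_lgt0 ?invr_lt0// subr_lt0.
by rewrite ltr_ndivrMr// mul1r; lra.
Qed.

(** Along the horizontal line [rside] is affine with slope [b.2 - a.2], and it vanishes at the
    crossing because it vanishes at [a] and [b]. *)
Lemma rside_horizontal a b (t y w : R) : segpt a b t = (line_x a b y, y) ->
  rside a b (w, y) = (b.2 - a.2) * (w - line_x a b y).
Proof.
move=> e; have := rside_segpt a b a b t; rewrite e.
have -> : rside a b a = 0 by rewrite /rside; ring.
have -> : rside a b b = 0 by rewrite /rside; ring.
by rewrite !mulr0 addr0 /rside /= => h; rewrite -[LHS]subr0 -h; ring.
Qed.

(** This is [indic_crossings] on the slice at height [y]. For [s = 1] the region lies to the left of
    an ascending edge and to the right of a descending one, hence the sign factor. *)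
Lemma region_section (I : finType) (a b : I -> R * R) (s : R) D (y : R) :
  edge_region a b s D -> (forall i, (a i).2 != y /\ (b i).2 != y) ->
  forall z, (forall i, edge_active a b y i -> z <> line_x (a i) (b i) y) ->
  \1_D (z, y) = \sum_(i | edge_active a b y i)
    s * Num.sg ((b i).2 - (a i).2) * (z < line_x (a i) (b i) y)%R%:R :> R.
Proof.
move=> rD yab; have [r bD] := er_bounded rD.
have sgE i : edge_active a b y i ->
    s * Num.sg ((b i).2 - (a i).2) = 1 \/ s * Num.sg ((b i).2 - (a i).2) = - 1.
  move=> Ai; have [+ _] := edge_active_param Ai; rewrite neq_lt.
  have sE := er_sign rD.
  case: sE => -> /orP[h|h].
  - by left; rewrite gtr0_sg ?subr_gt0// mulr1.
  - by right; rewrite ltr0_sg ?subr_lt0// mul1r.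
  - by right; rewrite gtr0_sg ?subr_gt0// mulr1.
  - by left; rewrite ltr0_sg ?subr_lt0// mulN1r opprK.
have := @indic_crossings R I [set w | D (w, y)] (edge_active a b y)
  (fun i => line_x (a i) (b i) y) (fun i => s * Num.sg ((b i).2 - (a i).2)) r.
have -> : \1_[set w | D (w, y)] = (fun w => \1_D (w, y)) :> (R -> R).
  by apply/funext => w; rewrite !indicE.
move=> ind; apply: ind => //.
- by move=> z /bD[].
(* If the point were on an edge, it would be an inner point of it, since no end point has height
   [y], and the edge would not be horizontal; so [z] would be a crossing. *)
- move=> z zx; have [i [t]|q q0 hq] := er_off rD (z := (z, y)).
    rewrite /= in_itv/= => /andP[t0 t1] e; have [ay by_] := yab i.
    have t0' : t != 0.
      apply/eqP => t0'; move: e; rewrite t0' segpt0 => e.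
      by move: ay; rewrite e eqxx.
    have t1' : t != 1.
      apply/eqP => t1'; move: e; rewrite t1' segpt1 => e.
      by move: by_; rewrite e eqxx.
    have t01 : 0 < t < 1 by rewrite !lt_neqAle eq_sym t0' t0 t1' t1.
    have ye : y = (1 - t) * (a i).2 + t * (b i).2 by rewrite -[LHS]/((z, y).2) -e.
    have ne : (a i).2 != (b i).2.
      apply/eqP => abe; move: ay; rewrite abe ye abe => /eqP; apply.
      by ring.
    apply: (zx i).
      case/andP: t01 => t0'' t1''.
      rewrite /edge_active ye; move: ne; rewrite neq_lt => /orP[h|h].
        by apply/orP; left; apply/andP; split; nra.
      by apply/orP; right; apply/andP; split; nra.
    have := segpt_line_x t ne; rewrite e.
    have -> : (a i).2 + t * ((b i).2 - (a i).2) = y by rewrite ye; ring.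
    by move=> [->].
  exists q => // w zw; apply: hq; split=> //=; by rewrite subrr normr0.
- move=> i j Ai Aj e.
  have [_ [t t01 te]] := edge_active_param Ai.
  have [_ [u u01 ue]] := edge_active_param Aj.
  by apply: (er_inj rD t01 u01); rewrite te ue e.
- move=> i Ai; have [ne [t t01 te]] := edge_active_param Ai.
  have [q q0 hq] := er_side rD i t01; exists q => // w xw wx.
  have n0 : (b i).2 - (a i).2 != 0 by rewrite subr_eq0 eq_sym.
  set x := line_x _ _ _ in te xw wx *; set d := (b i).2 - (a i).2 in n0 *.
  have rw : rside (a i) (b i) (w, y) = Num.sg d * `|d| * (w - x).
    by rewrite -numEsg (rside_horizontal w te).
  have d0 : 0 < `|d| by rewrite normr_gt0.
  apply: (iff_trans (hq (w, y) _ _)).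
  + by rewrite te; split=> //=; rewrite subrr normr0.
  + by rewrite rw -numEsg mulf_neq0// subr_eq0.
  rewrite rw.
  have -> : s * (Num.sg d * `|d| * (w - x)) = - (`|d| * (s * Num.sg d * (x - w))).
    by ring.
  by rewrite oppr_lt0 pmulr_rgt0.
Qed.

End Green.

(** * Integrals of partial derivatives over a region *)

Section GreenFormula.
Variable R : realType.
Notation mu := (@lebesgue_measure R).
Implicit Types (a b : R * R) (D : set (R * R)) (f P : R * R -> R).

Lemma area_intE D f : closed D ->
  (exists r : R, forall x, D x -> `|x.1| <= r /\ `|x.2| <= r) ->
  continuous f ->
  (@leb2 R).-integrable setT (fun z => (\1_D z * f z)%:E) /\
  (area_int D f)%:E = (\int[@leb2 R]_z (\1_D z * f z)%:E)%E.
Proof.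
move=> cD bD cf; have mD := closed_measurable2 cD.
have iD := continuous_integrable2 cD bD cf.
have E : (EFin \o f) \_ D = (fun z => (\1_D z * f z)%:E).
  apply/funext => z; rewrite patchE indicE.
  by case: ifPn => _; rewrite ?mul1r ?mul0r.
split.
  have [+ _] :=
    integrable_restrict (mu \x mu)%E mD measurableT (EFin \o f).
  by rewrite -E setTI; exact.
rewrite /area_int /Rintegral fineK.
  by rewrite integral_mkcond -E.
exact: integrable_fin_num.
Qed.

(** Fubini: the inner integral over a horizontal slice is a signed sum of values of [P] at the
    crossings, and integrating these over [y] gives one boundary integral per edge. *)
Lemma region_integral_d1 (I : finType) (a b : I -> R * R) (s : R) D f P :
  edge_region a b s D -> continuous P -> continuous f ->
  (forall x y, is_derive x (1 : R) (fun u => P (u, y)) (f (x, y))) ->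
  area_int D f = \sum_i s * (((b i).2 - (a i).2) *
    \int[mu]_(t in `[0, 1]) P (segpt (a i) (b i) t)).
Proof.
move=> rD cP cf dP; have cD := er_closed rD; have bD := er_bounded rD.
have [iD aE] := area_intE cD bD cf; apply: EFin_inj; rewrite {}aE.
rewrite -(integral21_prod_meas1 iD).
(* The heights of the vertices, to which [region_section] does not apply, form a finite and hence
   null set. *)
pose N := range (fun i => (a i).2) `|` range (fun i => (b i).2).
have fN : finite_set N by rewrite finite_setU; split; exact: finite_image.
pose h i y : R := (edge_active a b y i)%:R *
  (Num.sg ((b i).2 - (a i).2) * P (line_x (a i) (b i) y, y)).
have ih i : mu.-integrable setT (EFin \o h i).
  set m := Num.min (a i).2 (b i).2; set M := Num.max (a i).2 (b i).2.
  pose g y := Num.sg ((b i).2 - (a i).2) * P (line_x (a i) (b i) y, y).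
  have cg : continuous g.
    move=> y; apply: cvgM; first exact: cvg_cst.
    apply: continuous_comp; last exact: cP.
    apply: (pair_continuous (line_x_continuous (a := a i) (b := b i))) => ?.
    exact: cvg_id.
  have E : EFin \o h i = (EFin \o g) \_ `]m, M[.
    apply/funext => y; rewrite patchE mem_setE in_itv/= /h /edge_active -/(g y).
    rewrite gt_min lt_max.
    case: (ltgtP y (a i).2) => h1; case: (ltgtP y (b i).2) => h2 /=;
      by rewrite ?mul1r ?mul0r.
  have [+ _] :=
    integrable_restrict mu (measurable_itv `]m, M[) measurableT (EFin \o g).
  rewrite E setTI; apply.
  apply: integrableS (continuous_itv_integrable m M cg) => //.
  exact: subset_itv_oo_cc.
pose H y := \sum_i s * h i y.
rewrite (@integral_eq_off_finite R N _ (EFin \o H) fN); last 3 first.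
- exact: (measurable_fubini_G iD).
- rewrite /H /comp/=; under eq_fun do rewrite -sumEFin.
  apply: (measurable_int mu); apply: (integrable_sum measurableT) => i _.
  exact: (integrableZl measurableT s (ih i)).
- move=> y yN; rewrite /fubini_G /=.
  have yab i : (a i).2 != y /\ (b i).2 != y.
    by split; apply/eqP => e; apply: yN; [left|right]; exists i.
  have [r hr] := bD.
  have S := region_section rD yab.
  have mS : measurable [set x | D (x, y)].
    apply: closed_measurable.
    apply: (@closed_comp _ _ (fun x => (x, y))) cD => x _.
    by apply: pair_continuous => ?; [exact: cvg_id|exact: cvg_cst].
  have cfy : continuous (fun x => f (x, y)).
    move=> x; apply: continuous_comp; last exact: cf.
    by apply: pair_continuous => ?; [exact: cvg_id|exact: cvg_cst].
  rewrite (_ : (fun x => _) = (fun x => (\1_[set x | D (x, y)] x * f (x, y))%:E)).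
    rewrite (integral_crossings mS cfy (dP^~ y) (M := r) _ S); last first.
      by move=> z /hr[].
    rewrite /H big_mkcond; congr EFin; apply: eq_bigr => i _.
    by rewrite /h; case: ifP => _; rewrite ?mul1r ?mul0r ?mulr0// mulrA.
  by apply/funext => x; rewrite !indicE.
rewrite /H /comp/=; under eq_integral do rewrite -sumEFin.
rewrite integral_sum//; last first.
  by move=> i; exact: (integrableZl measurableT s (ih i)).
rewrite -sumEFin; apply: eq_bigr => i _.
rewrite [RHS]EFinM -integral_edge// -(integralZl measurableT (ih i) s).
by apply: eq_integral => y _; rewrite /= EFinM.
Qed.

End GreenFormula.

Section Divergence.
Variable R : realType.
Notation mu := (@lebesgue_measure R).
Implicit Types (D : set (R * R)) (f P Q : R * R -> R).

Lemma area_int_swap D f : closed D ->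
  (exists r : R, forall x, D x -> `|x.1| <= r /\ `|x.2| <= r) ->
  continuous f -> area_int (@swap R @^-1` D) (f \o @swap R) = area_int D f.
Proof.
move=> cD [r bD] cf; apply: EFin_inj.
have [|||i1 ->] := @area_intE R (@swap R @^-1` D) (f \o @swap R).
- by apply: closed_comp cD => ? _; exact: swap_continuous.
- by exists r => x /bD[].
- by move=> x; apply: continuous_comp; [exact: swap_continuous|exact: cf].
have [i2 ->] := area_intE cD (ex_intro _ r bD) cf.
(* Iterated integrals in opposite orders, so that the integrands coincide. *)
rewrite -(integral21_prod_meas1 i1) -(integral12_prod_meas1 i2).
apply: eq_integral => y _; apply: eq_integral => x _.
by rewrite !indicE.
Qed.

(** This is [region_integral_d1] for the swapped region, whose sign is [- s]. *)
Lemma region_integral_d2 (I : finType) (a b : I -> R * R) (s : R) D f P :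
  edge_region a b s D -> continuous P -> continuous f ->
  (forall x y, is_derive y (1 : R) (fun u => P (x, u)) (f (x, y))) ->
  area_int D f = \sum_i - s * (((b i).1 - (a i).1) *
    \int[mu]_(t in `[0, 1]) P (segpt (a i) (b i) t)).
Proof.
move=> rD cP cf dP.
rewrite -(area_int_swap (er_closed rD) (er_bounded rD) cf).
have cPs : continuous (P \o @swap R).
  by move=> x; apply: continuous_comp; [exact: swap_continuous|exact: cP].
have cfs : continuous (f \o @swap R).
  by move=> x; apply: continuous_comp; [exact: swap_continuous|exact: cf].
rewrite (region_integral_d1 (swap_region rD) cPs cfs (fun x y => dP y x)).
by apply: eq_bigr => i _; congr (_ * (_ * _)).
Qed.

(** The length in [seg_int] cancels the denominators of [rnormal], so each edge term is the sum of
    those in the two coordinate formulas. *)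
Theorem polygon_divergence N (p : 'I_N -> R * R) D P Q f g :
  polygon p D -> continuous P -> continuous Q -> continuous f -> continuous g ->
  (forall x y, is_derive x (1 : R) (fun u => P (u, y)) (f (x, y))) ->
  (forall x y, is_derive y (1 : R) (fun u => Q (x, u)) (g (x, y))) ->
  area_int D (fun x => f x + g x) =
  \sum_i seg_int (p i) (p (ordS i)) (fun x =>
    let n := rnormal (p i) (p (ordS i)) in n.1 * P x + n.2 * Q x).
Proof.
move=> pD cP cQ cf cg dP dQ; have rD := polygon_region pD.
have cD := er_closed rD; have bD := er_bounded rD.
have mD := closed_measurable2 cD.
rewrite /area_int RintegralD//; [|exact: continuous_integrable2..].
rewrite -!/(area_int _ _) (region_integral_d1 rD cP cf dP).
rewrite (region_integral_d2 rD cQ cg dQ) -big_split; apply: eq_bigr => i _.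
have cs (F : R * R -> R) : continuous F ->
    mu.-integrable `[0, 1] (EFin \o (fun t => F (segpt (p i) (p (ordS i)) t))).
  move=> cF; apply: continuous_itv_integrable => t.
  by apply: continuous_comp; [exact: segpt_continuous|exact: cF].
rewrite /seg_int; set n := rnormal (p i) (p (ordS i)).
rewrite RintegralD//; first last.
- apply: (cs (fun x => n.2 * Q x)) => x.
  by apply: cvgM; [exact: cvg_cst|exact: cQ].
- apply: (cs (fun x => n.1 * P x)) => x.
  by apply: cvgM; [exact: cvg_cst|exact: cP].
rewrite !RintegralZl//; [|exact: cs..].
have d0 : dist2 (p i) (p (ordS i)) != 0.
  by rewrite gt_eqF// dist2_gt0//; exact: polygon_edge_neq pD.
rewrite /n /rnormal /=.
by set IP := Rintegral _ _ _; set IQ := Rintegral _ _ _; field.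
Qed.

End Divergence.

(** * Bivariate polynomials and their projections *)

Section BipolyEval.
Variable R : realType.
Implicit Types (p q : bipoly R) (x z : R * R).

Lemma pevalD p q z : peval (p + q) z = peval p z + peval q z.
Proof. by rewrite /peval !hornerD. Qed.

Lemma pevalN p z : peval (- p) z = - peval p z.
Proof. by rewrite /peval !hornerN. Qed.

Lemma pevalB p q z : peval (p - q) z = peval p z - peval q z.
Proof. by rewrite pevalD pevalN. Qed.

Lemma pevalM p q z : peval (p * q) z = peval p z * peval q z.
Proof. by rewrite /peval !hornerM. Qed.

Lemma pevalC (c : R) z : peval c%:P%:P z = c.
Proof. by rewrite /peval !hornerC. Qed.

Lemma peval0 z : peval 0 z = 0 :> R.
Proof. by rewrite /peval !horner0. Qed.

Lemma peval_swapE p (x y : R) : peval p (x, y) = (map_poly (horner_eval y) p).[x].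
Proof. by rewrite -[x in RHS](hornerC x y) -/(horner_eval y _) horner_map. Qed.

(** Induction along Horner's scheme: [dY] acts on the coefficients, and the constant [z.1%:P] at
    which [p] is evaluated has derivative 0. *)
Lemma peval_dYE p z : peval (dY p) z = (p.[z.1%:P])^`().[z.2].
Proof.
rewrite /peval; congr horner; move: z => [x y] /=; rewrite /dY.
elim/poly_ind: p => [|p c ih]; first by rewrite map_poly0 !horner0 deriv0.
rewrite raddfD /= hornerD [in RHS]hornerD derivD !hornerE map_polyC/=.
have -> : map_poly (@deriv R) (p * 'X) = map_poly (@deriv R) p * 'X.
  by apply/polyP => i; rewrite !(coef_map, coefMX)/= (fun_if (@deriv R)) deriv0.
by rewrite hornerMX ih !hornerE derivM derivC mulr0 addr0.
Qed.

Lemma peval_continuous p : continuous (peval p).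
Proof.
elim/poly_ind: p => [|p c ih] z.
  have -> : peval 0 = cst 0 :> (R * R -> R) by apply/funext => w; rewrite peval0.
  exact: cvg_cst.
have -> : peval (p * 'X + c%:P) = (fun w => peval p w * w.1 + c.[w.2]).
  by apply/funext => w; rewrite /peval !hornerE.
apply: cvgD; first by apply: cvgM; [exact: ih|exact: cvg_fst].
by apply: continuous_comp; [exact: cvg_snd|exact: continuous_horner].
Qed.

Lemma is_derive_dX p (x y : R) :
  is_derive x (1 : R) (fun u => peval p (u, y)) (peval (dX p) (x, y)).
Proof.
rewrite peval_swapE /dX -deriv_map.
have -> : (fun u => peval p (u, y)) = horner (map_poly (horner_eval y) p).
  by apply/funext => u; rewrite peval_swapE.
exact: is_derive_poly.
Qed.

Lemma is_derive_dY p (x y : R) :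
  is_derive y (1 : R) (fun u => peval p (x, u)) (peval (dY p) (x, y)).
Proof. by rewrite peval_dYE; exact: (is_derive_poly p.[x%:P] y). Qed.

Lemma peval_dXM p q z : peval (dX (p * q)) z =
  peval (dX p) z * peval q z + peval p z * peval (dX q) z.
Proof. by rewrite /dX derivM pevalD !pevalM. Qed.

Lemma peval_dYM p q z : peval (dY (p * q)) z =
  peval (dY p) z * peval q z + peval p z * peval (dY q) z.
Proof. by rewrite !peval_dYE hornerM derivM hornerD !hornerM. Qed.

Lemma poly_eq0_roots (A : idomainType) (q : {poly A}) (f : nat -> A) :
  injective f -> (forall n, q.[f n] = 0) -> q = 0.
Proof.
move=> fI qf; apply/eqP; apply: contraT => q0.
have := max_poly_roots q0 (rs := [seq f n | n <- iota 0 (size q)]).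
rewrite map_inj_uniq// iota_uniq size_map size_iota ltnn; apply=> //.
by apply/allP => _ /mapP[n _ ->]; rewrite /root qf.
Qed.

(** The square contains an infinite grid. Roots are counted first in the outer variable, over
    [{poly R}], then in the inner one. *)
Lemma bipoly_eq0 p x (r : R) : 0 < r -> (forall w, esq x r w -> peval p w = 0) ->
  p = 0.
Proof.
move=> r0 p0.
(* Infinitely many distinct points; a denominator of at least 2 keeps them at distance less than [r]
   from [c]. *)
pose f (c : R) (n : nat) := c + r / n.+2%:R.
have fI c : injective (f c).
  move=> m n /addrI/(mulfI (lt0r_neq0 r0))/invr_inj/eqP.
  by rewrite eqr_nat => /eqP[].
have fr c n : `|c - f c n| < r.
  rewrite /f opprD addNKr normrN gtr0_norm ?divr_gt0//.
  by rewrite ltr_pdivrMr// ltr_pMr// ltr1n.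
apply: (@poly_eq0_roots _ p (fun n => (f x.1 n)%:P)).
  by move=> m n /polyC_inj/fI.
move=> n; apply: (@poly_eq0_roots _ _ (f x.2)) => // m.
by apply: (p0 (f x.1 n, f x.2 m)); split; exact: fr.
Qed.

(** Turns pointwise identities, such as still water on a cell, into identities between
    polynomials. *)
Lemma bipoly_eq p q (D : set (R * R)) : D° !=set0 ->
  (forall w, D° w -> peval p w = peval q w) -> p = q.
Proof.
move=> [z Dz] pq; have : nbhs z D°.
  by apply: open_nbhs_nbhs; split; first exact: open_interior.
move=> /nbhs_esq[r r0 hr]; apply/eqP; rewrite -subr_eq0; apply/eqP.
apply: (bipoly_eq0 r0) => w /hr/pq pqw.
by rewrite pevalB pqw subrr.
Qed.

End BipolyEval.

(** * Projections of polynomials *)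

Section L2Projection.
Variable R : realType.
Notation mu := (@lebesgue_measure R).
Implicit Types (p q : bipoly R) (D : set (R * R)).

Lemma leb2_esq_gt0 (x : R * R) (r : R) : 0 < r -> (0 < leb2 (esq x r))%E.
Proof.
move=> r0.
rewrite esq_setX /leb2 product_measure1E//; try exact: measurable_itv.
have h (c : R) : (0 < mu `](c - r)%R, (c + r)%R[)%E.
  rewrite lebesgue_measure_itv/= lte_fin; have -> : c - r < c + r by lra.
  by rewrite -?EFinB lte_fin; lra.
by rewrite mule_gt0 ?h.
Qed.

(** The square of [f] vanishes almost everywhere on [D]. If [f] were nonzero at an interior point,
    it would by continuity be nonzero on a whole square, which has positive measure. *)
Lemma area_int_sqr_eq0 D (f : R * R -> R) : closed D ->
  (exists r : R, forall x, D x -> `|x.1| <= r /\ `|x.2| <= r) ->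
  continuous f -> area_int D (fun x => f x * f x) = 0 ->
  forall x, D° x -> f x = 0.
Proof.
move=> cD bD cf ff0 x Dx; have mD := closed_measurable2 cD.
have cff : continuous (fun x => f x * f x).
  by move=> y; apply: cvgM; exact: cf.
have iD := continuous_integrable2 cD bD cff.
have ae0 : ae_eq (@leb2 R) D (fun x => (f x * f x)%:E) (cst 0%E).
  have [+ _] := ae_eq_integral_abs (mu \x mu)%E mD (measurable_int _ iD).
  apply.
  have : (area_int D (fun x => f x * f x))%:E = 0%E by rewrite ff0.
  rewrite /area_int /Rintegral fineK; last exact: integrable_fin_num.
  move=> <-; apply: eq_integral => y _.
  by rewrite gee0_abs// lee_fin -expr2 sqr_ge0.
case: ae0 => N [mN N0 hN].
apply: contrapT => fx0.
have : nbhs x [set y | D° y /\ f y != 0].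
  apply: filterI; first by apply: open_nbhs_nbhs; split; first exact: open_interior.
  apply: (cf x [set c | c != 0]); apply: open_nbhs_nbhs; split; last exact/eqP.
  exact: open_neq.
move=> /nbhs_esq[r r0 hr].
have : (leb2 (esq x r) <= leb2 N)%E.
  apply: le_measure; rewrite ?inE//; first exact: measurable_esq.
  move=> y /hr[Dy fy0]; apply: hN => /= /(_ (interior_subset Dy)) [] /eqP.
  by rewrite mulf_eq0 orbb (negbTE fy0).
move=> /(lt_le_trans (leb2_esq_gt0 x r0)).
by rewrite [X in (_ < X)%E](N0 : _ = 0%E) ltxx.
Qed.

Lemma bideg_leB k p q : bideg_le k p -> bideg_le k q -> bideg_le k (p - q).
Proof. by move=> hp hq i j ij; rewrite !coefB hp// hq// subr0. Qed.

(** As [q] itself satisfies [is_L2proj], the choice in [L2proj] is a genuine projection [q'].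
    Testing with [q - q'] makes the integral of its square vanish, hence [q' = q]. *)
Lemma L2proj_id D l q : closed D ->
  (exists r : R, forall x, D x -> `|x.1| <= r /\ `|x.2| <= r) ->
  D° !=set0 -> bideg_le l q -> L2proj D l (peval q) = q.
Proof.
move=> cD bD D0 ql.
have [q'l hq'] : is_L2proj D l (peval q) (L2proj D l (peval q)).
  by apply: (@xgetPex _ 0); exists q.
set q' := L2proj _ _ _ in q'l hq' *.
have mD := closed_measurable2 cD.
have d := hq' (q - q') (bideg_leB ql q'l).
have i p : (@leb2 R).-integrable D
    (EFin \o (fun x => peval p x * peval (q - q') x)).
  apply: continuous_integrable2 => // x.
  by apply: cvgM; exact: peval_continuous.
apply/esym/(bipoly_eq D0) => x Dx; apply/eqP; rewrite -subr_eq0 -pevalB; apply/eqP.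
apply: (area_int_sqr_eq0 cD bD (@peval_continuous R (q - q'))) => //.
rewrite -[RHS](subrr (area_int D (fun x => peval q x * peval (q - q') x))).
rewrite {2}d /area_int -RintegralB//.
by apply: eq_Rintegral => y _; rewrite !pevalB; ring.
Qed.

(** [D] contains its vertices and is the closure of its interior. *)
Lemma polygon_interior_nonempty N (p : 'I_N -> R * R) D :
  polygon p D -> D° !=set0.
Proof.
move=> P; have N0 : (0 < N)%N by apply: leq_trans (polygon_size P).
have : D (p (Ordinal N0)).
  apply: (polygon_edge_sub (i := Ordinal N0) P).
  by exists 0; rewrite ?segpt0//= in_itv/= lexx ler01.
rewrite {1}(polygon_regular P) => /(_ setT) [|x [Dx _]]; last by exists x.
exact: filterT.
Qed.

End L2Projection.

(** * Still water *)

Section StillWater.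
Variables (R : realType) (g : R).
Implicit Types (U : 'cV[R]_3).

Lemma dot3_col3 (a b c : R) (w : 'cV[R]_3) :
  dot3 (col3 a b c) w = a * w 0 0 + b * w 1 0 + c * w 2 0.
Proof.
rewrite /dot3 !big_ord_recl big_ord0 !mxE /= addr0 addrA.
by congr (_ + _ * w _ _ + _ * w _ _); apply: val_inj.
Qed.

Lemma fluxF_rest U : hu U = 0 -> fluxF g U = col3 0 (g / 2 * hgt U ^+ 2) 0.
Proof.
by move=> u0; rewrite /fluxF /velu u0 mul0r expr0n/= mulr0 add0r mul0r.
Qed.

Lemma fluxG_rest U : hv U = 0 -> fluxG g U = col3 0 0 (g / 2 * hgt U ^+ 2).
Proof.
by move=> v0; rewrite /fluxG /velv v0 mul0r expr0n/= !mulr0 add0r.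
Qed.

Lemma col3D (A : nmodType) (a b c a' b' c' : A) :
  col3 a b c + col3 a' b' c' = col3 (a + a') (b + b') (c + c').
Proof.
apply/matrixP => i j; rewrite !mxE.
by case: i => [[|[|[|]]]].
Qed.

Lemma scale_col3 (c x y z : R) :
  c *: col3 x y z = col3 (c * x) (c * y) (c * z).
Proof.
apply/matrixP => i j; rewrite !mxE.
by case: i => [[|[|[|]]]].
Qed.

Section Hydrostatic.
Variables (n : R * R) (Ui Ue : 'cV[R]_3) (bi be C : R).
Hypotheses (n1 : unit_vector n) (hi : 0 < hgt Ui) (he : 0 < hgt Ue).
Hypotheses (ui : hu Ui = 0) (vi : hv Ui = 0) (ue : hu Ue = 0) (ve : hv Ue = 0).
Hypotheses (Ci : hgt Ui + bi = C) (Ce : hgt Ue + be = C).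

Let bs := Num.max bi be.

(** The reconstructed height is [C - max bi be], the smaller of the two water heights. *)
Lemma rec_height_gt0 : 0 < rec_height Ui bi bs.
Proof.
rewrite /rec_height Ci lt_max; apply/orP; right.
by rewrite subr_gt0 /bs gt_max -{1}Ci -Ce !ltrDr hi.
Qed.

Lemma rec_state_eq : rec_state Ue be bs = rec_state Ui bi bs.
Proof. by rewrite /rec_state /rec_height Ci Ce ui vi ue ve. Qed.

(** Consistency gives the pressure of the reconstructed height; the correction term replaces it by
    the pressure of the inner height. *)
Lemma hydroF_rest (Fh : numflux R) : consistent Fh (fluxF g) ->
  hydroF g Fh n Ui Ue bi be = col3 0 (g / 2 * hgt Ui ^+ 2) 0.
Proof.
move=> cF; rewrite /hydroF -/bs rec_state_eq.
have hE : hgt (rec_state Ui bi bs) = rec_height Ui bi bs by rewrite /hgt mxE.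
rewrite cF ?hE ?rec_height_gt0// fluxF_rest; last by rewrite /hu mxE/=.
by rewrite col3D hE !addr0; congr col3; ring.
Qed.

Lemma hydroG_rest (Gh : numflux R) : consistent Gh (fluxG g) ->
  hydroG g Gh n Ui Ue bi be = col3 0 0 (g / 2 * hgt Ui ^+ 2).
Proof.
move=> cG; rewrite /hydroG -/bs rec_state_eq.
have hE : hgt (rec_state Ui bi bs) = rec_height Ui bi bs by rewrite /hgt mxE.
rewrite cG ?hE ?rec_height_gt0// fluxG_rest; last by rewrite /hv mxE/=.
by rewrite col3D hE !addr0; congr col3; ring.
Qed.

End Hydrostatic.

End StillWater.

(** * Cells of the mesh and the residual at rest *)

Section Cells.
Variable R : realType.

Lemma rnormal_unit (a b : R * R) : a <> b -> unit_vector (rnormal a b).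
Proof.
move=> ab; have d0 := dist2_gt0 ab; rewrite /unit_vector /rnormal/=.
rewrite mulNr sqrrN !expr_div_n -mulrDl.
have -> : (b.2 - a.2) ^+ 2 + (b.1 - a.1) ^+ 2 = dist2 a b ^+ 2.
  by rewrite dist2_sqr; ring.
by rewrite divff// expf_neq0// gt_eqF.
Qed.

Lemma segmentC (a b : R * R) : segment a b `<=` segment b a.
Proof.
move=> _ [t t01 <-]; exists (1 - t); last by rewrite segptC.
by move: t01; rewrite /= !in_itv/= => /andP[t0 t1]; apply/andP; split; lra.
Qed.

(** By conformity the edge is also an edge of [K'], traversed backwards. The still water condition
    on [K'] thus applies to the exterior trace. *)
Lemma mesh_edge_neighbour (Omega : set (R * R)) (M : mesh Omega) (K K' : elt M)
    (i : 'I_(nedges K)) (x : R * R) : nbr i = Some K' ->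
  segment (vtx i) (vtx (ordS i)) x -> cell K' x.
Proof.
move=> /mesh_conform[_ [j [j1 j2]]] /segmentC; rewrite -j1 -j2.
exact: polygon_edge_sub (cell_polygon K').
Qed.

Lemma area_int_pevalD (D : set (R * R)) (p q : bipoly R) : closed D ->
  (exists r : R, forall x, D x -> `|x.1| <= r /\ `|x.2| <= r) ->
  area_int D (peval p) + area_int D (peval q) = area_int D (peval (p + q)).
Proof.
move=> cD bD; rewrite /area_int -RintegralD.
- by apply: eq_Rintegral => x _; rewrite pevalD.
- exact: closed_measurable2.
- by apply: continuous_integrable2 => //; exact: peval_continuous.
- by apply: continuous_integrable2 => //; exact: peval_continuous.
Qed.

Lemma bideg_leC k (c : R) : bideg_le k c%:P%:P.
Proof.
by case=> [|i] [|j] //= ij; rewrite !coefC//= coefC.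
Qed.

End Cells.

Theorem proposition3p1 (R : realType) (Omega : set (R * R)) (M : mesh Omega)
  (g : R) (k : nat) (Fh Gh : numflux R) (av : average_kind)
  (b : R * R -> R) (bh : dgfun M) (U : dgvec M)
  (Uext : bdata_state M) (bext : bdata_bottom M) (C : R)
  (Omega_open : open Omega)
  (g_gt0 : 0 < g)
  (k_ge1 : (1 <= k)%N)
  (Fh_consistent : consistent Fh (fluxF g))
  (Gh_consistent : consistent Gh (fluxG g))
  (b_L2 : forall K : elt M, square_integrable (cell K) b)
  (bh_proj : is_L2projection k b bh)
  (U_Vh : in_Vh3 k U)
  (h_gt0 : forall (K : elt M) (x : R * R), cell K x -> 0 < hgt (U_int U K x))
  (hext_gt0 : forall (K : elt M) (i : 'I_(nedges K)) (x : R * R),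
     nbr i = None -> segment (vtx i) (vtx (ordS i)) x ->
     0 < hgt (Uext K i 0%N 0%N x))
  (still_water : forall (K : elt M) (x : R * R), cell K x ->
     [/\ hu (U_int U K x) = 0,
         hv (U_int U K x) = 0 &
         hgt (U_int U K x) + b_int bh K x = C])
  (still_water_ext : forall (K : elt M) (i : 'I_(nedges K)) (x : R * R),
     nbr i = None -> segment (vtx i) (vtx (ordS i)) x ->
     [/\ hu (Uext K i 0%N 0%N x) = 0,
         hv (Uext K i 0%N 0%N x) = 0 &
         hgt (Uext K i 0%N 0%N x) + bext K i x = C]) :
  forall (K : elt M) (v : dgvec M), in_Vh3 k v ->
    Res g k Fh Gh av Uext bext U bh v K = 0.
Proof.
move=> K v _; have PK := cell_polygon K; have rK := polygon_region PK.
have cD := er_closed rK; have bD := er_bounded rK.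
have D0 := polygon_interior_nonempty PK.
have hpoly : hgt (U K) + bh K = C%:P%:P.
  apply: (bipoly_eq D0) => x /interior_subset/still_water[_ _ e].
  by rewrite pevalD pevalC -e /U_int /hgt mxE.
have hu0 : hu (U K) = 0.
  apply: (bipoly_eq D0) => x /interior_subset/still_water[e _ _].
  by rewrite peval0 -e /U_int /hu mxE.
have hv0 : hv (U K) = 0.
  apply: (bipoly_eq D0) => x /interior_subset/still_water[_ e _].
  by rewrite peval0 -e /U_int /hv mxE.
have huK x : hu (U_int U K x) = 0 by rewrite /hu mxE -/(hu (U K)) hu0 peval0.
have hvK x : hv (U_int U K x) = 0 by rewrite /hv mxE -/(hv (U K)) hv0 peval0.
set h := hgt (U K) in hpoly.
have hK x : hgt (U_int U K x) = peval h x by rewrite /hgt mxE.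
have bhE : bh K = C%:P%:P - h by rewrite -hpoly addrC addKr.
(* [G] is the hydrostatic pressure and [(P, Q)] the field for the divergence theorem; only the
   momentum components of [v] enter, as the mass flux vanishes at rest. *)
pose G : bipoly R := (g / 2)%:P%:P * (h * h).
pose P := G * v K 1 0; pose Q := G * v K 2 0.
have GX x : peval (dX G) x = g * peval h x * peval (dX h) x.
  rewrite !peval_dXM [dX _%:P%:P]derivC peval0 pevalC pevalM.
  by field.
have GY x : peval (dY G) x = g * peval h x * peval (dY h) x.
  rewrite !peval_dYM {1}/dY map_polyC/= derivC polyC0 peval0 pevalC pevalM.
  by field.
have damp : damping_term g k av Uext U bh v K = 0.
  have Ut : Utilde U bh K = col3 C%:P%:P 0 0 by rewrite /Utilde -/h hpoly hu0 hv0.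
  (* A constant has degree at most [l] for every [l], including the value 0 of [l.-1] at [l = 0]. *)
  have Up l : vproj l (Utilde U bh) K = Utilde U bh K.
    apply/matrixP => i j; rewrite mxE; apply: L2proj_id => //.
    rewrite Ut mxE; case: i => [[|[|[|]]]] //= _; rewrite -1?polyC0;
      exact: bideg_leC.
  rewrite /damping_term big1// => l _; rewrite Up subrr.
  rewrite [X in _ * X](_ : _ = 0) ?mulr0// /area_int.
  rewrite (eq_Rintegral _ (g := cst 0)); last first.
    by move=> x _; rewrite /dot3 big1// => i _; rewrite !mxE peval0 mul0r.
  by rewrite /Rintegral integral0.
have vol : volume_term g U v K + source_term g U bh v K =
    area_int (cell K) (fun x => peval (dX P) x + peval (dY Q) x).
  (* [A] and [B] are the two halves of the product rule for the divergence of [(P, Q)], with the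
     derivative on [v] and on the pressure; the sign in [source] is absorbed by [bhE]. *)
  pose A : bipoly R := G * dX (v K 1 0) + G * dY (v K 2 0).
  pose B : bipoly R := g%:P%:P * (h * dX h * v K 1 0 + h * dY h * v K 2 0).
  have -> : volume_term g U v K = area_int (cell K) (peval A).
    apply: eq_Rintegral => x _.
    rewrite fluxF_rest// fluxG_rest// !dot3_col3 hK !mxE /A pevalD !pevalM !pevalC.
    by ring.
  have -> : source_term g U bh v K = area_int (cell K) (peval B).
    apply: eq_Rintegral => x _; rewrite /source dot3_col3 hK !mxE bhE.
    have -> : dX (C%:P%:P - h) = - dX h by rewrite /dX derivB derivC sub0r.
    have -> : dY (C%:P%:P - h) = - dY h.
      by rewrite /dY raddfB /= map_polyC /= derivC polyC0 sub0r.
    by rewrite /B !pevalM pevalD !pevalN !pevalM pevalC; ring.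
  rewrite area_int_pevalD//; apply: eq_Rintegral => x _.
  rewrite pevalD /P /Q peval_dXM peval_dYM GX GY /A /B !(pevalD, pevalM, pevalC).
  by ring.
have bdry : boundary_term g Fh Gh Uext bext U bh v K =
    area_int (cell K) (fun x => peval (dX P) x + peval (dY Q) x).
  have dP x y := is_derive_dX P x y.
  have dQ x y := is_derive_dY Q x y.
  rewrite (polygon_divergence PK (@peval_continuous R P) (@peval_continuous R Q)
    (@peval_continuous R _) (@peval_continuous R _) dP dQ).
  apply: eq_bigr => i _; congr (_ * _); apply: eq_Rintegral => t /set_mem t01.
  set x := segpt _ _ t.
  have xS : segment (vtx i) (vtx (ordS i)) x by exists t.
  have Dx : cell K x by exact: polygon_edge_sub PK xS.
  have nu : unit_vector (normal i).
    by apply: rnormal_unit; exact: polygon_edge_neq PK.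
  have [_ _ Ci] := still_water _ _ Dx.
  (* The exterior trace comes from the neighbour or from the boundary data; both are at rest with
     the same constant [C]. *)
  have [ue ve Ce he] : [/\ hu (U_ext Uext U i x) = 0, hv (U_ext Uext U i x) = 0,
      hgt (U_ext Uext U i x) + b_ext bext bh i x = C & 0 < hgt (U_ext Uext U i x)].
    rewrite /U_ext /derU_ext /b_ext; case E : (nbr i) => [K'|].
      have Dx' := mesh_edge_neighbour E xS.
      have -> : derU_int U K' 0 0 x = U_int U K' x.
        by rewrite /derU_int /U_int; congr veval; apply/matrixP => r s; rewrite mxE.
      by have [? ? ?] := still_water _ _ Dx'; split=> //; exact: h_gt0.
    by have [? ? ?] := still_water_ext _ _ _ E xS; split=> //; exact: hext_gt0.
  cbv zeta; rewrite -/(normal i).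
  rewrite (hydroF_rest nu (h_gt0 _ _ Dx) he (huK x) (hvK x) ue ve Ci Ce
    Fh_consistent).
  rewrite (hydroG_rest nu (h_gt0 _ _ Dx) he (huK x) (hvK x) ue ve Ci Ce
    Gh_consistent).
  rewrite !scale_col3 col3D dot3_col3 !mxE /P /Q !(pevalM, pevalC) hK.
  by rewrite -/(normal i); ring.
by rewrite /Res damp bdry subr0 addrAC vol subrr.
Qed.
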